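(* Let $d=1$ and $a\equiv 1$. Let $\Phi\in C^1(\mathbb{R})$ be such that $$g(y,x)=\mathcal{F}_\xi^{-1}\mathcal{L}_\zeta^{-1}\left(\frac{2}{2\,\zeta\,\Phi\!\left(\frac{\xi^2}{\zeta}\right)+1}\right)$$ is well defined for $x\in\mathbb{R}$ and $y>0$. Then $$t^{-\frac52}\,g\!\left(\frac mt,\frac{p}{\sqrt t}\right)$$ is a self-similar solution of $$\partial_t f(t,m,p)=\frac12\int_{\mathbb{R}}\int_0^m f(t,m-m',p-p')\,f(t,m',p')\,dm'dp'-f(t,m,p)\int_{\mathbb{R}}\int_0^\infty f(t,m',p')\,dm'dp'.$$
   Context: The equation is the ballistic aggregation equation with constant rate $a\equiv1$ for the density $f(t,m,p)$ of particles of mass $m>0$ and impulsion (momentum) $p\in\mathbb{R}$. A self-similar solution is a solution of the form $f(t,m,p)=t^{-\alpha}\varphi(t^{-1}m,t^{-\beta}p)$ for some function $\varphi$ (here $\alpha=5/2$, $\beta=1/2$). $\mathcal{F}_\xi^{-1}$ denotes the inverse Fourier transform (from $\xi$ to $x$) and $\mathcal{L}_\zeta^{-1}$ the inverse Laplace transform (from $\zeta$ to $y$). *)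

(* Defs.v *)
From HB Require Import structures.
From mathcomp Require Import all_boot all_order all_algebra.
From mathcomp Require Import complex.
From mathcomp Require Import all_classical all_reals all_analysis.

Set Implicit Arguments.
Unset Strict Implicit.
Unset Printing Implicit Defensive.

Import Order.TTheory GRing.Theory Num.Theory.
Import numFieldNormedType.Exports.

Local Open Scope classical_set_scope.
Local Open Scope ring_scope.

Definition C1 (R : realType) (u : R -> R) : Prop :=
  (forall x, derivable u x 1) /\ continuous (derive1 u).

(* The phase space ]0, +oo[ x R of pairs (mass, momentum). *)
Definition phase (R : realType) : set (R * R) := `]0, +oo[%classic `*` setT.
Arguments phase R : clear implicits.

Notation leb2 R := ((@lebesgue_measure R) \x (@lebesgue_measure R))%E.

Definition in_L1 (R : realType) (u : R -> R -> R) : Prop :=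
  (leb2 R).-integrable (phase R) (fun z => (u z.1 z.2)%:E).

(* xi |-> \int_R e^(- i xi x) u(x) dx, with e^(- i s) = cos s - i sin s. *)
Definition fourier (R : realType) (u : R -> R) (xi : R) : R[i] :=
  Complex (\int[@lebesgue_measure R]_x (cos (xi * x) * u x))
          (- \int[@lebesgue_measure R]_x (sin (xi * x) * u x)).

(* zeta |-> \int_0^oo e^(- zeta y) v(y) dy, componentwise. *)
Definition laplace (R : realType) (v : R -> R[i]) (zeta : R) : R[i] :=
  Complex (\int[@lebesgue_measure R]_(y in `]0%R, +oo[)
             (expR (- (zeta * y)) * complex.Re (v y)))
          (\int[@lebesgue_measure R]_(y in `]0%R, +oo[)
             (expR (- (zeta * y)) * complex.Im (v y))).

(* g = F_xi^-1 L_zeta^-1 G, the transforms being those of Lebesgue integrable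
   functions on the phase space, so that g is determined almost everywhere.
   The Laplace variable is real because G (zeta, xi) is only available for
   zeta > 0 and xi real.  Integrability gives g(y, .) in L^1(R) for almost
   every y, which is enough for the iterated transform. *)
Definition is_inverse_fourier_laplace (R : realType) (G : R -> R -> R)
    (g : R -> R -> R) : Prop :=
  in_L1 g /\
  forall zeta xi : R, 0 < zeta ->
    laplace (fun y => fourier (g y) xi) zeta = (G zeta xi)%:C%C.

Definition gain (R : realType) (f : R -> R -> R -> R) (t m p : R) : R :=
  2^-1 * \int[@lebesgue_measure R]_p' \int[@lebesgue_measure R]_(m' in `]0%R, m[)
           (f t (m - m') (p - p') * f t m' p').

Definition loss (R : realType) (f : R -> R -> R -> R) (t m p : R) : R :=
  f t m p * \int[@lebesgue_measure R]_p' \int[@lebesgue_measure R]_(m' in `]0%R, +oo[)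
              f t m' p'.

Definition rhs (R : realType) (f : R -> R -> R -> R) (t m p : R) : R :=
  gain f t m p - loss f t m p.

(* Real-valued integrals default to 0 on non-integrable functions: this
   predicate makes both integrals on the right-hand side meaningful (the gain
   integral for almost every (m, p)). *)
Definition rhs_defined (R : realType) (f : R -> R -> R -> R) (t : R) : Prop :=
  [/\ in_L1 (f t),
      {ae leb2 R, forall z : R * R, phase R z ->
         (leb2 R).-integrable (`]0, z.1[%classic `*` setT)
           (fun w => (f t (z.1 - w.1) (z.2 - w.2) * f t w.1 w.2)%:E)} &
      in_L1 (rhs f t)].

(* A function known through its transforms is only an element of L^1, so the
   time derivative is that of the curve t |-> f t in L^1 of the phase space. *)
Definition L1_derivative (R : realType) (f : R -> R -> R -> R) (t : R)
    (q : R -> R -> R) : Prop :=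
  (fun h : R => \int[leb2 R]_(z in phase R)
     (`| (f (t + h) z.1 z.2 - f t z.1 z.2) / h - q z.1 z.2 |)%:E)%E @ 0^'
    --> 0%E.

Definition strong_solution (R : realType) (f : R -> R -> R -> R) : Prop :=
  forall t : R, 0 < t -> rhs_defined f t /\ L1_derivative f t (rhs f t).

Definition classical_solution (R : realType) (f : R -> R -> R -> R) : Prop :=
  forall t m p : R, 0 < t -> 0 < m ->
    is_derive t 1 (fun s => f s m p) (rhs f t m p).

Definition continuous_density (R : realType) (f : R -> R -> R -> R) : Prop :=
  forall t m p : R, 0 < t -> 0 < m ->
    {for ((t, m), p), continuous (fun z : R * R * R => f z.1.1 z.1.2 z.2)}.

(* The equation holds in L^1 at every time t > 0, and also at every point as
   soon as the terms involved are continuous (an L^1 class need not have a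
   pointwise time derivative). *)
Definition solution (R : realType) (f : R -> R -> R -> R) : Prop :=
  strong_solution f /\
  (continuous_density f -> continuous_density (gain f) -> classical_solution f).

Definition self_similar (R : realType) (alpha beta : R)
    (f : R -> R -> R -> R) : Prop :=
  exists phi : R -> R -> R, forall t m p : R, 0 < t -> 0 < m ->
    f t m p = t `^ (- alpha) * phi (t^-1 * m) (t `^ (- beta) * p).

(* Main.v *)
Require Import Defs.
From HB Require Import structures.
From mathcomp Require Import all_boot all_order all_algebra.
From mathcomp Require Import complex.
From mathcomp Require Import all_classical all_reals all_analysis.
From mathcomp Require Import measurable_realfun.
From mathcomp Require Import ring lra.

Set Implicit Arguments.
Unset Strict Implicit.
Unset Printing Implicit Defensive.

Import Order.TTheory GRing.Theory Num.Theory.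
Import numFieldNormedType.Exports.

Local Open Scope classical_set_scope.
Local Open Scope ring_scope.

(** Let [F t] be the Fourier-Laplace transform of [f t]. Then
    [1 / (t^2 F t) - 1 / (2 t)] does not depend on [t], so [t^2 (f t)] obeys
    the resolvent identity in [1 / (2 t)] for the convolution product: first
    for transforms, then almost everywhere because the transform is injective
    on L^1 of the phase space. With [norm (u * v) <= norm u * norm v] the
    identity makes [f] Lipschitz, and then differentiable, in L^1; the
    derivative is gain minus loss because the total mass of [f t], the limit
    of its transform at 0, is [2 / t].
    Injectivity: the polynomials [(1 - z^n)^(n 2^n)] turn the kernels
    [e^(- zeta y)] and [(1 + sin (xi (al - x))) / 2] into indicators of
    half-lines, and a Dynkin class argument reaches all measurable sets.
    Pointwise equation: integrate over a small box, apply the mean value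
    theorem in time, and shrink the box. *)

(** * Affine changes of variables *)

Section affine.
Context {R : realType}.
Local Notation mu := (@lebesgue_measure R).

(** Integrating the equation over the phase space gives M' = - M^2 / 2 for the total mass M, which
    suggests M = 2 / t. The transformed equation is then the Bernoulli equation F' = F^2 / 2 - (2 /
    t) F, and 1 / (t^2 F) - 1 / (2 t) is its constant of integration. Here that constant is zeta
    Phi(xi^2 / zeta): it is multiplied by t under (zeta, xi) -> (t zeta, sqrt t xi), exactly as
    self-similarity requires. Differentiating the transforms in t would not suffice, since
    convergence of transforms does not control the L^1 norm. The resolvent identity compares two
    times without any limit, so it can be carried over to L^1 and differentiated there. The
    transform is known at real zeta > 0 only and nothing is known about its decay, so an inversion
    formula is out of reach; injectivity is obtained by enlarging the set of bounded functions whose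
    integral against the unknown vanishes. *)

Lemma measurable_affine (a c : R) :
  measurable_fun setT (fun x : R => a * x + c).
Proof.
by apply: measurable_funD => //; exact: measurable_funM.
Qed.

Lemma affine_preimage_itvoc (a c x y : R) : 0 < a ->
  (fun r => a * r + c) @^-1` `]x, y]%classic =
  `](x - c) / a, (y - c) / a]%classic.
Proof.
move=> a0; apply/seteqP; split => r /=; rewrite !in_itv/=
  ltr_pdivrMr// ler_pdivlMr// ltrBlDr lerBrDr (mulrC r); done.
Qed.

(** The pushforward scaled by [a] agrees with Lebesgue measure on half-open intervals, hence on all
    Borel sets by uniqueness. The planar version below repeats this with rectangles. *)
Lemma lebesgue_measure_affine (a c : R) (A : set R) : 0 < a -> measurable A ->
  (mu ((fun r : R => a * r + c)%R @^-1` A) = a^-1%:E * mu A)%E.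
Proof.
move=> a0 mA.
pose phi0 : measurableTypeR R -> measurableTypeR R := fun r => a * r + c.
have mphi : measurable_fun setT phi0 by exact: measurable_affine.
pose nu' : {measure set (measurableTypeR R) -> \bar R} :=
  mscale (NngNum (ltW a0)) (pushforward mu phi0).
have E := @lebesgue_measure_unique R (nu' mphi) _ A mA.
rewrite -[LHS]mul1e -(mulVf (lt0r_neq0 a0)) EFinM -muleA E//.
move=> _ [[x y]] _ <-; rewrite /nu'/= /mscale/= /pushforward /= /phi0.
rewrite affine_preimage_itvoc// !lebesgue_measure_itv/= !lte_fin.
rewrite ltr_pM2r ?invr_gt0// ltrD2r; case: ifPn => _; last by rewrite mule0.
rewrite -!EFinB -EFinM; congr EFin; field; exact: lt0r_neq0.
Qed.

Local Notation mu2 := (leb2 R).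

Local Notation mR := (measurableTypeR R).
Local Notation T := (measurableTypeR R * measurableTypeR R)%type.

Definition affine2 (a b c d : R) (z : T) : T :=
  (a * z.1 + c, b * z.2 + d).

Lemma measurable_affine2 (a b c d : R) :
  measurable_fun setT (affine2 a b c d).
Proof.
apply/measurable_fun_pairP; split => /=.
  rewrite [_ \o _](_ : _ = (fun r : mR => a * r + c : mR) \o fst)//.
  apply: measurableT_comp; last exact: measurable_fst.
  exact: measurable_affine.
rewrite [_ \o _](_ : _ = (fun r : mR => b * r + d : mR) \o snd)//.
apply: measurableT_comp; last exact: measurable_snd.
exact: measurable_affine.
Qed.

Lemma leb2_affine (a b c d : R) (A : set T) :
  0 < a -> 0 < b -> measurable A ->
  (mu2 (affine2 a b c d @^-1` A) = ((a * b)^-1)%:E * mu2 A)%E.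
Proof.
move=> a0 b0 mA.
have ab0 : 0 <= a * b by rewrite mulr_ge0// ltW.
have mphi := measurable_affine2 a b c d.
pose phi := affine2 a b c d.
pose nu' : {measure set T -> \bar R} :=
  mscale (NngNum ab0) (pushforward mu2 phi).
have E := @product_measure_unique _ _ _ _ R mu mu (nu' mphi) _ A mA.
rewrite -[LHS]mul1e -(@mulVf _ (a * b)) ?mulf_neq0 ?lt0r_neq0// EFinM -muleA
  E//.
move=> B C mB mC; rewrite /nu'/= /mscale/= /pushforward /=.
have -> : phi @^-1` (B `*` C) =
  ((fun r => a * r + c) @^-1` B) `*` ((fun r => b * r + d) @^-1` C) by [].
rewrite product_measure1E//.
- rewrite [X in (_ * (X * _))%E](lebesgue_measure_affine c a0 mB).
  rewrite [X in (_ * (_ * X))%E](lebesgue_measure_affine d b0 mC) EFinM muleACA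
    (muleCA b%:E).
  rewrite !muleA -!EFinM divff ?lt0r_neq0// mul1e.
  by rewrite -(muleA (mu B)) -EFinM mulVf ?lt0r_neq0// mule1.
- by rewrite -[X in measurable X]setTI; exact: measurable_affine.
- by rewrite -[X in measurable X]setTI; exact: measurable_affine.
Qed.

Lemma ge0_integral_affine2 (a b c d : R) (F : T -> \bar R) :
  0 < a -> 0 < b -> measurable_fun setT F -> (forall z, 0 <= F z)%E ->
  (\int[mu2]_z F (affine2 a b c d z) = ((a * b)^-1)%:E * \int[mu2]_z F z)%E.
Proof.
move=> a0 b0 mF F0.
have ab0 : 0 <= (a * b)^-1 by rewrite invr_ge0 mulr_ge0// ltW.
have := ge0_integral_pushforward (measurable_affine2 a b c d) mu2 measurableT mF
  (fun z _ => F0 z).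
rewrite preimage_setT => /= <-.
rewrite -(@ge0_integral_mscale _ _ _ mu2 _ measurableT (NngNum ab0))//.
apply: eq_measure_integral => [|mphi A mA _].
  exact: measurable_affine2.
rewrite /= /mscale /=; exact: leb2_affine.
Qed.

Lemma integral_affine2 (a b c d : R) (F : T -> \bar R) :
  0 < a -> 0 < b -> mu2.-integrable setT F ->
  (\int[mu2]_z F (affine2 a b c d z) = ((a * b)^-1)%:E * \int[mu2]_z F z)%E.
Proof.
move=> a0 b0 iF; have mF := measurable_int _ iF.
rewrite integralE [in RHS]integralE.
under eq_integral do rewrite funepos_comp/=.
under [X in (_ - X)%E = _]eq_integral do rewrite funeneg_comp/=.
rewrite !ge0_integral_affine2//; last 2 first.
- exact: measurable_funeneg.
- exact: measurable_funepos.
rewrite [RHS]muleBr//.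
exact: integrable_add_def.
Qed.

Lemma integrable_affine2 (a b c d : R) (F : T -> \bar R) :
  0 < a -> 0 < b -> mu2.-integrable setT F ->
  mu2.-integrable setT (F \o affine2 a b c d).
Proof.
move=> a0 b0 /integrableP[mF iF]; apply/integrableP; split.
  exact: (measurableT_comp mF (measurable_affine2 a b c d)).
rewrite (@ge0_integral_affine2 a b c d (fun z => `|F z|%E))//.
  by rewrite lte_mul_pinfty ?lee_fin ?invr_ge0 ?mulr_ge0 ?ltW.
exact: measurableT_comp.
Qed.

End affine.

(** * Injectivity of the Fourier-Laplace transform *)

Section sharpening.
Context {R : realType}.
Implicit Types x z : R.

(** Bernoulli's inequality for [(1 + x) ^+ n] turns the left side into at most a power of
    [1 - x ^+ 2]. The result serves as a decay rate for [(1 - x) ^+ n]. *)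
Lemma expr_mul_one_sub_le x n : 0 <= x <= 1 ->
  (1 - x) ^+ n * (1 + n%:R * x) <= 1.
Proof.
move=> /andP[x0 x1].
have bern : 1 + n%:R * x <= (1 + x) ^+ n.
  elim: n => [|n IH]; first by rewrite mul0r addr0 expr0.
  rewrite exprS; apply: (@le_trans _ _ ((1 + x) * (1 + n%:R * x))).
    rewrite -natr1; have : 0 <= x * (n%:R * x) by rewrite !mulr_ge0.
    nra.
  by rewrite ler_wpM2l// addr_ge0.
apply: (@le_trans _ _ ((1 - x) ^+ n * (1 + x) ^+ n)).
  by rewrite ler_wpM2l// exprn_ge0// subr_ge0.
rewrite -exprMn exprn_ile1//; nra.
Qed.

Lemma bernoulli_one_sub x n : 0 <= x <= 1 -> 1 - n%:R * x <= (1 - x) ^+ n.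
Proof.
move=> /andP[x0 x1]; elim: n => [|n IH]; first by rewrite mul0r subr0 expr0.
rewrite exprS; apply: (@le_trans _ _ ((1 - x) * (1 - n%:R * x))).
  rewrite -natr1; have : 0 <= x * (n%:R * x) by rewrite !mulr_ge0.
  nra.
by rewrite ler_wpM2l// subr_ge0.
Qed.

Lemma cvg_natr_mul_expr x : 0 <= x < 1 -> (n%:R * x ^+ n : R) @[n --> \oo] -->
  (0 : R).
Proof.
move=> /andP[x0 x1].
have [->|xn0] := eqVneq x 0.
  apply: cvg_near_cst; near=> n; rewrite expr0n.
  have -> : (n == 0)%N = false by apply/negbTE; rewrite -lt0n; near: n;
    exact: nbhs_infty_gt.
  by rewrite mulr0.
(* The previous bound at [1 - y] gives [n * y ^+ n <= (1 - y)^-1], so [n * x ^+ n], which is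
   [n * y ^+ n] times [y ^+ n], is dominated by a geometric sequence. *)
pose y := Num.sqrt x.
have y0 : 0 < y by rewrite sqrtr_gt0 lt0r xn0.
have y1 : y < 1 by rewrite -sqrtr1 ltr_sqrt.
have xE : x = y ^+ 2 by rewrite sqr_sqrtr.
apply: (@squeeze_cvgr _ _ _ _ (fun=> 0) (geometric (1 - y)^-1 y)).
- near=> n; rewrite mulr_ge0 ?exprn_ge0//=.
  have yn0 : 0 <= y ^+ n by rewrite exprn_ge0// ltW.
  rewrite xE -exprM mulnC exprM expr2 mulrA ler_wpM2r//.
  rewrite -[leRHS]mulr1 ler_pdivlMl ?subr_gt0//.
  have ye : 0 <= 1 - y <= 1 by apply/andP; split; lra.
  have := expr_mul_one_sub_le n ye.
  rewrite (_ : 1 - (1 - y) = y); last by ring.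
  nra.
- exact: cvg_cst.
- by apply: cvg_geometric; rewrite ger0_norm ?ltW.
Unshelve. all: by end_near.
Qed.

(* Brosowski-Deutsch: these polynomials in [z] separate the two sides of 1/2;
   the extra factor [n] in the exponent settles the endpoint. *)
Lemma cvg_sharpening z : 0 <= z <= 1 ->
  ((1 - z ^+ n) ^+ (n * 2 ^ n) : R) @[n --> \oo] --> ((z < 2^-1)%R%:R : R).
Proof.
move=> /andP[z0 z1].
have zn n : 0 <= z ^+ n <= 1 by rewrite exprn_ge0// exprn_ile1.
have E n : (n * 2 ^ n)%:R * z ^+ n = n%:R * (2 * z) ^+ n.
  by rewrite exprMn natrM natrX mulrA.
have [zlt|zge] := ltP z 2^-1.
  apply: (@squeeze_cvgr _ _ _ _ (fun n => 1 - n%:R * (2 * z) ^+ n) (fun=> 1)).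
  - near=> n; rewrite -E bernoulli_one_sub//= exprn_ile1//.
      by rewrite subr_ge0; case/andP: (zn n).
    by rewrite gerBl; case/andP: (zn n).
  - rewrite -[X in _ --> X]subr0; apply: cvgB; first exact: cvg_cst.
    by apply: cvg_natr_mul_expr; lra.
  - exact: cvg_cst.
apply: (@squeeze_cvgr _ _ _ _ (fun=> 0) (fun n => harmonic n)).
- near=> n; rewrite exprn_ge0 ?subr_ge0; last by case/andP: (zn n).
  rewrite /harmonic/= -(ler_pM2r (_ : 0 < n.+1%:R)) ?ltr0n// mulVf//.
  apply: le_trans (expr_mul_one_sub_le (n * 2 ^ n) (zn n)).
  rewrite ler_wpM2l//.
    by rewrite exprn_ge0 ?subr_ge0; case/andP: (zn n).
  rewrite E -natr1 addrC lerD2l ler_peMr// exprn_ege1//; lra.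
- exact: cvg_cst.
- exact: cvg_harmonic.
Unshelve. all: by end_near.
Qed.

(** Once the frequency is so low that [x] falls within half a period of 0, the sine has the sign of
    [x]. This is how periodic functions produce indicators of half-lines. *)
Lemma cvg_sin_neg x :
  ((sin (n.+1%:R^-1 * x) < 0)%R%:R : R) @[n --> \oo] --> ((x < 0)%R%:R : R).
Proof.
have main y : 0 < y -> \forall n \near \oo, 0 < sin (n.+1%:R^-1 * y : R).
  move=> y0; near=> n; apply: sin_gt0_pi.
  rewrite mulr_gt0//= ltr_pdivrMl//.
  apply: (@lt_le_trans _ _ (n.+1%:R)); last by rewrite ler_peMr// ; have :=
    @pi_ge2 R; lra.
  near: n; exists (Num.truncn y) => // n /= yn.
  by rewrite (lt_le_trans (truncnS_gt _))// ler_nat ltnS.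
apply: cvg_near_cst; have [x0|x0|->] := ltgtP x 0.
- have := main (- x); rewrite oppr_gt0 => /(_ x0); apply: filterS => n.
  by rewrite mulrN sinN oppr_gt0 => ->.
- by apply: filterS (main _ x0) => n sn; rewrite ltNge ltW.
- by apply: nearW => n; rewrite mulr0 sin0 ltxx.
Unshelve. all: by end_near.
Qed.

End sharpening.

(** * Bounded functions annihilating an integrable function *)

Section annihilator.
Context d (T : measurableType d) (R : realType) (m : {measure set T -> \bar R}).
Variable h : T -> R.
Hypothesis ih : m.-integrable setT (EFin \o h).

(** Vanishing of the total integral gives stability under complements, countable additivity gives
    disjoint unions. The map [phi] lets one statement serve for either coordinate and, with the
    identity, for the product. *)
Lemma dynkin_integral0 d' (X : measurableType d') (phi : T -> X)
    (G : set (set X)) :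
  measurable_fun setT phi ->
  @measurable _ X = <<s G >> -> setI_closed G ->
  (\int[m]_z (h z)%:E = 0)%E ->
  (forall S, G S -> (\int[m]_(z in phi @^-1` S) (h z)%:E = 0)%E) ->
  forall S, measurable S -> (\int[m]_(z in phi @^-1` S) (h z)%:E = 0)%E.
Proof.
move=> mphi GE GI hT hG S; rewrite GE.
have mpre A : measurable A -> measurable (phi @^-1` A).
  by move=> mA; rewrite -[X in measurable X]setTI; exact: mphi.
apply: (@dynkin_induction _ X G
  (fun S => \int[m]_(z in phi @^-1` S) (h z)%:E = 0)%E) => //.
- move=> A mA hA; have mpA := mpre _ mA.
  have := hT; rewrite -(setvU (phi @^-1` A)) integral_setU//=.
  + by rewrite hA adde0 preimage_setC.
  + exact: measurableC.
  + rewrite setvU; exact: measurable_int ih.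
  + by apply/disj_setPRL; rewrite setCK.
- move=> F mF tF hF; rewrite preimage_bigcup integral_bigcup.
  + by rewrite eseries0// => i _ _; exact: hF.
  + apply/trivIsetP => i j _ _ ij; rewrite -preimage_setI.
    by move/trivIsetP : tF => /(_ _ _ I I ij) ->; rewrite preimage_set0.
  + by move=> k; exact: mpre.
  + apply: integrableS ih => //; apply: bigcup_measurable => k _; exact: mpre.
Qed.

(** Measurability and boundedness are carried along so that every product with [h] is integrable.
    The class is then a vector space, closed under uniformly bounded pointwise limits. *)
Definition annihilates (psi : T -> R) := [/\ measurable_fun setT psi,
  (exists M : R, forall z, `|psi z| <= M) &
  (\int[m]_z (psi z * h z)%:E = 0)%E].

Lemma integrable_bounded_mul (psi : T -> R) M :
  measurable_fun setT psi -> (forall z, `|psi z| <= M) ->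
  m.-integrable setT (fun z => (psi z * h z)%:E).
Proof.
move=> mpsi bpsi; apply: (@le_integrable _ _ _ m setT measurableT _
  (fun z => M%:E * (h z)%:E)%E) => //.
- apply/measurable_EFinP; apply: measurable_funM => //.
  by apply/measurable_EFinP; exact: measurable_int ih.
- move=> z _; rewrite -EFinM !abse_EFin lee_fin !normrM ler_wpM2r//.
  exact: le_trans (bpsi z) (ler_norm _).
- exact: integrableZl.
Qed.

Lemma annihilates_lin (a : R) (psi1 psi2 : T -> R) :
  annihilates psi1 -> annihilates psi2 ->
  annihilates (fun z => a * psi1 z + psi2 z).
Proof.
move=> [m1 [M1 b1] i1] [m2 [M2 b2] i2]; split.
- by apply: measurable_funD => //; exact: measurable_funM.
- exists (`|a| * M1 + M2) => z; apply: le_trans (ler_normD _ _) _.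
  by rewrite lerD// normrM ler_wpM2l.
- under eq_integral do rewrite mulrDl -mulrA EFinD EFinM.
  rewrite integralD//=.
  + by rewrite integralZl//= ?i1 ?i2 ?mule0 ?adde0//;
      exact: integrable_bounded_mul b1.
  + by apply: integrableZl => //; exact: integrable_bounded_mul b1.
  + exact: integrable_bounded_mul b2.
Qed.

Lemma annihilates_eq (psi1 psi2 : T -> R) :
  psi1 =1 psi2 -> annihilates psi1 -> annihilates psi2.
Proof. by move=> /funext ->. Qed.

Lemma annihilates_lim (psi : nat -> T -> R) (f : T -> R) (M : R) :
  (forall n, annihilates (psi n)) -> (forall n z, `|psi n z| <= M) ->
  (forall z, psi n z @[n --> \oo] --> f z) -> annihilates f.
Proof.
move=> apsi bpsi cpsi.
have mf : measurable_fun setT f.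
  by apply: (@measurable_fun_cvg _ _ _ _ psi) => // n; case: (apsi n).
have bf z : `|f z| <= M.
  apply: (@ler_cvg_to _ \oo _ _ (fun n => `|psi n z|) (fun=> M)).
  - exact: cvg_norm.
  - exact: cvg_cst.
  - exact: nearW.
split => //; first by exists M.
have mpsi n : measurable_fun setT (fun z => (psi n z * h z)%:E).
  have [mpn [Mn bn] _] := apsi n.
  exact: measurable_int (integrable_bounded_mul mpn bn).
have [] := @dominated_convergence _ T R m setT measurableT
  (fun n z => (psi n z * h z)%:E) (fun z => (f z * h z)%:E)
  (fun z => M%:E * `|(h z)%:E|)%E mpsi.
- exact: measurable_int (integrable_bounded_mul mf bf).
- apply: aeW => z _; apply: cvg_EFin; first exact: nearW.
  apply: cvgM; [exact: cpsi|exact: cvg_cst].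
- by apply: integrableZl => //; exact: integrable_abse.
- by apply: aeW => z n _; rewrite !abse_EFin -EFinM lee_fin normrM ler_wpM2r.
move=> _ _ /(cvg_lim (@ereal_hausdorff R)) <-.
rewrite (_ : (fun _ => _) = fun=> 0%E).
  by apply/cvg_lim => //; exact: cvg_cst.
by apply/funext => n; case: (apsi n).
Qed.

Lemma annihilates0 : annihilates (fun=> 0).
Proof.
split => //; first by exists 0 => z; rewrite normr0.
by under eq_integral do rewrite mul0r; rewrite integral0.
Qed.

(** Horner's scheme: writing the polynomial as [p * 'X + c] moves one factor [zf] into the weight,
    which is why [phi] varies in the induction. *)
Lemma annihilates_horner (phi zf : T -> R) (p : {poly R}) :
  (forall j, annihilates (fun z => phi z * zf z ^+ j)) ->
  annihilates (fun z => phi z * p.[zf z]).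
Proof.
move=> aj; elim/poly_ind: p phi aj => [|p c IH] phi aj.
  by apply: annihilates_eq annihilates0 => z; rewrite horner0 mulr0.
have := annihilates_lin c (aj 0%N) (IH (fun z => phi z * zf z) _).
move=> /(_ _)/wrap[].
  by move=> j; apply: annihilates_eq (aj j.+1) => z; rewrite exprS mulrA.
apply: annihilates_eq => z; rewrite hornerMXaddC expr0; ring.
Qed.

(** The sharpening polynomials in [zf] stay between 0 and 1 because [zf] does, so dominated
    convergence applies to them; only powers of [zf] have to be checked beforehand. *)
Lemma annihilates_threshold (phi zf : T -> R) :
  (forall z, 0 <= zf z <= 1) ->
  (forall j, annihilates (fun z => phi z * zf z ^+ j)) ->
  annihilates (fun z => phi z * (zf z < 2^-1)%R%:R).
Proof.
move=> zf01 aj; have [_ [M bphi] _] := aj 0%N.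
pose p n : {poly R} := (1 - 'X ^+ n) ^+ (n * 2 ^ n).
have pE n x : (p n).[x] = (1 - x ^+ n) ^+ (n * 2 ^ n).
  by rewrite /p !hornerE.
apply: (@annihilates_lim (fun n z => phi z * (p n).[zf z]) _ M).
- by move=> n; exact: annihilates_horner.
- move=> n z; rewrite pE normrM.
  have /andP[z0 z1] := zf01 z.
  have M0 : `|phi z| <= M by have := bphi z; rewrite expr0 mulr1.
  rewrite -[leRHS]mulr1 ler_pM// ger0_norm.
    by rewrite exprn_ile1// ?subr_ge0 ?exprn_ile1// gerBl exprn_ge0.
  by rewrite exprn_ge0// subr_ge0 exprn_ile1.
- move=> z; apply: cvgM; first exact: cvg_cst.
  by under eq_fun do rewrite pE; exact: cvg_sharpening.
Qed.

End annihilator.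

(** * From vanishing transforms to vanishing integrals over rectangles *)

Section uniqueness.
Context {R : realType}.
Local Notation mR := (measurableTypeR R).
Local Notation T := (measurableTypeR R * measurableTypeR R)%type.
Local Notation mu2 := (leb2 R).

Lemma measurable_fst_leb2 : measurable_fun [set: T] (fun z : T => z.1 : R).
Proof. exact: (@measurable_fst _ _ mR mR). Qed.

Lemma measurable_snd_leb2 : measurable_fun [set: T] (fun z : T => z.2 : R).
Proof. exact: (@measurable_snd _ _ mR mR). Qed.

(* [Num.max y 0] keeps the Laplace kernel bounded on the whole line. *)
Definition lkernel (zeta y : R) : R := expR (- (zeta * Num.max y 0)).

Lemma lkernel_ge0 zeta y : 0 <= lkernel zeta y.
Proof. exact: expR_ge0. Qed.

Lemma lkernel_le1 zeta y : 0 <= zeta -> lkernel zeta y <= 1.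
Proof.
move=> z0; rewrite /lkernel -[leRHS]expR0 ler_expR oppr_le0 mulr_ge0//.
by rewrite le_max lexx orbT.
Qed.

Lemma lkernelX zeta y j : lkernel zeta y ^+ j = lkernel (j%:R * zeta) y.
Proof. by rewrite /lkernel -expRM_natl -mulrA mulrN. Qed.

Lemma measurable_lkernel zeta :
  measurable_fun [set: T] (fun z : T => lkernel zeta z.1).
Proof.
apply: (measurableT_comp (@measurable_expR R)).
apply: measurable_funN; apply: measurable_funM => //.
by apply: measurable_maxr => //; exact: measurable_fst_leb2.
Qed.

Lemma cvg_lkernel y : lkernel n.+1%:R^-1 y @[n --> \oo] --> (1 : R).
Proof.
rewrite -[X in _ --> X]expR0 /lkernel.
apply: continuous_cvg; first exact: continuous_expR.
rewrite -[X in _ --> X]oppr0; apply: cvgN.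
rewrite -[X in _ --> X](mul0r (Num.max y 0)).
by apply: cvgM; [exact: cvg_harmonic|exact: cvg_cst].
Qed.

Lemma norm_cos_le1 (x : R) : `|cos x| <= 1.
Proof. by rewrite ler_norml cos_geN1 cos_le1. Qed.

Lemma norm_bool_le1 (b : bool) : `|b%:R : R| <= 1.
Proof. by case: b; rewrite ?normr1 ?normr0. Qed.

Lemma norm_sin_le1 (x : R) : `|sin x| <= 1.
Proof. by rewrite ler_norml sin_geN1 sin_le1. Qed.

Lemma measurable_cos_affine (xi b : R) :
  measurable_fun [set: T] (fun z : T => cos (xi * z.2 + b)).
Proof.
apply: (measurableT_comp (continuous_measurable_fun (@continuous_cos R))).
by apply: measurable_funD => //; exact: measurable_funM.
Qed.

Variable h : T -> R.
Hypothesis ih : mu2.-integrable setT (EFin \o h).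
Hypothesis h_supp : forall z : T, z.1 <= 0 -> h z = 0.
Hypothesis transform0 : forall zeta xi : R, 0 < zeta ->
  (\int[mu2]_z (lkernel zeta z.1 * cos (xi * z.2) * h z)%:E = 0)%E /\
  (\int[mu2]_z (lkernel zeta z.1 * sin (xi * z.2) * h z)%:E = 0)%E.

Let ann := annihilates mu2 h.

(** The free phase [b] covers cosine and sine at once, and makes the span of these functions stable
    under multiplication by a cosine. *)
Let ann_lkernel_cos zeta xi b : 0 < zeta ->
  ann (fun z => lkernel zeta z.1 * cos (xi * z.2 + b)).
Proof.
move=> z0; have [hc hs] := transform0 xi z0.
have mcos : measurable_fun [set: T] (fun z : T => cos (xi * z.2)).
  by have := measurable_cos_affine xi 0; under eq_fun do rewrite addr0.
have msin : measurable_fun [set: T] (fun z : T => sin (xi * z.2)).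
  have := measurable_cos_affine xi (- (pi / 2)).
  by under eq_fun do rewrite cosBpihalf.
have bd (c : T -> R) : (forall z, `|c z| <= 1) ->
    exists M : R, forall z : T, `|lkernel zeta z.1 * c z| <= M.
  move=> c1; exists 1 => z; rewrite normrM mulr_ile1//.
  by rewrite ger0_norm ?lkernel_ge0// lkernel_le1 ?ltW.
have annc : ann (fun z => lkernel zeta z.1 * cos (xi * z.2)).
  split => //; first by apply: measurable_funM => //; exact: measurable_lkernel.
  by apply: bd => z; exact: norm_cos_le1.
have anns : ann (fun z => lkernel zeta z.1 * sin (xi * z.2)).
  split => //; first by apply: measurable_funM => //; exact: measurable_lkernel.
  by apply: bd => z; exact: norm_sin_le1.
have := annihilates_lin ih (cos b) annc
  (annihilates_lin ih (- sin b) anns (annihilates0 _ _)).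
by apply: annihilates_eq => z; rewrite cosD; ring.
Qed.

Let ann_cos xi b : ann (fun z => cos (xi * z.2 + b)).
Proof.
apply: (@annihilates_lim _ _ _ _ _ ih
  (fun n z => lkernel n.+1%:R^-1 z.1 * cos (xi * z.2 + b)) _ 1).
- by move=> n; apply: ann_lkernel_cos.
- move=> n z; rewrite normrM mulr_ile1 ?norm_cos_le1//.
  by rewrite ger0_norm ?lkernel_ge0// lkernel_le1.
- move=> z; rewrite -[X in _ --> X]mul1r.
  by apply: cvgM; [exact: cvg_lkernel|exact: cvg_cst].
Qed.

Let ann_ray_cos a xi b : ann
  (fun z => (a < z.1 :> R)%R%:R * cos (xi * z.2 + b)).
Proof.
(* For [a <= 0] the indicator differs from 1 only where [h] vanishes. *)
have [a0|a0] := leP a 0.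
  have [mc bc ic] := ann_cos xi b; split.
  - apply: measurable_funM => //; apply: measurableT_comp => //.
    by apply: measurable_fun_ltr => //; exact: measurable_fst_leb2.
  - exists 1 => z; rewrite normrM mulr_ile1 ?norm_cos_le1 ?norm_bool_le1//.
  - rewrite -ic; apply: eq_integral => z _; congr EFin.
    have [az|za] := ltP a z.1; first by rewrite mul1r.
    by rewrite h_supp ?mulr0// (le_trans za).
have l2 : 0 < ln (2 : R) by rewrite ln_gt0// ltr1n.
(* At rate [ln 2 / a] the Laplace kernel equals 1/2 exactly at mass [a], so it is below 1/2 exactly
   beyond [a]. Its powers are again Laplace kernels, except the power 0, which is why [ann_cos] had
   to come first. *)
have := @annihilates_threshold _ _ _ _ _ ih (fun z => cos (xi * z.2 + b))
  (fun z => lkernel (ln 2 / a) z.1).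
move=> /(_ _ _)/wrap[].
- by move=> z; rewrite lkernel_ge0 lkernel_le1// divr_ge0 ?ltW.
- move=> j; have [->|j0] := posnP j.
    by apply: annihilates_eq (ann_cos xi b) => z; rewrite expr0 mulr1.
  apply: annihilates_eq (@ann_lkernel_cos (j%:R * (ln 2 / a)) xi b _).
    by move=> z; rewrite lkernelX mulrC.
  by rewrite mulr_gt0 ?ltr0n// divr_gt0.
apply: annihilates_eq => z; rewrite mulrC; congr (_ %:R * _).
rewrite /lkernel -[2^-1]lnK ?posrE ?invr_gt0// ltr_expR lnV ?posrE//.
rewrite ltrN2 -[X in X < _]mulr1 -mulrA ltr_pM2l// ltr_pdivlMl// mulr1.
by rewrite lt_max (lt_gtF a0) orbF.
Qed.

Let ann_rectangle a al :
  ann (fun z => (a < z.1 :> R)%R%:R * (al < z.2 :> R)%R%:R).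
Proof.
pose zf xi (z : T) := (1 + sin (xi * (al - z.2))) / 2.
have zfE xi z : zf xi z = 2^-1 + 2^-1 * cos (- xi * z.2 + (xi * al - pi / 2)).
  by rewrite /zf addrA cosBpihalf mulrBr mulNr (addrC (- _)); ring.
(* Each factor [zf] is 1/2 plus half a cosine, and the product of two cosines is half the sum of two
   others. This yields the coefficients 1/2, 1/4, 1/4 and shifts frequency and phase, so both are
   quantified inside the induction. *)
have annj xi j : forall xi' b,
    ann (fun z => (a < z.1 :> R)%R%:R * cos (xi' * z.2 + b) * zf xi z ^+ j).
  elim: j => [|j IH] xi' b.
    by apply: annihilates_eq (ann_ray_cos a xi' b) => z; rewrite expr0 mulr1.
  have := annihilates_lin ih 2^-1 (IH xi' b)
    (annihilates_lin ih 4^-1 (IH (- xi + xi') (xi * al - pi / 2 + b))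
    (annihilates_lin ih 4^-1 (IH (- xi - xi') (xi * al - pi / 2 - b))
       (annihilates0 _ _))).
  apply: annihilates_eq => z; rewrite exprS [X in _ = _ * (X * _)]zfE.
  rewrite (_ : (- xi + xi') * z.2 + _ = (- xi * z.2 + (xi * al - pi / 2)) +
    (xi' * z.2 + b)); last by ring.
  rewrite (_ : (- xi - xi') * z.2 + _ = (- xi * z.2 + (xi * al - pi / 2)) -
    (xi' * z.2 + b)); last by ring.
  set A := - xi * z.2 + _; set B := xi' * z.2 + b.
  by rewrite (cosD A B) (cosB A B); field.
apply: (@annihilates_lim _ _ _ _ _ ih
  (fun n z => (a < z.1 :> R)%R%:R * (zf n.+1%:R^-1 z < 2^-1)%R%:R) _ 1).
- move=> n; apply: annihilates_threshold => //.
    move=> z; rewrite /zf; have := sin_geN1 (n.+1%:R^-1 * (al - z.2)).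
    have := sin_le1 (n.+1%:R^-1 * (al - z.2)); lra.
  move=> j; have := annj n.+1%:R^-1 j 0 0.
  by apply: annihilates_eq => z; rewrite mul0r addr0 cos0 mulr1.
- by move=> n z; rewrite normrM mulr_ile1 ?norm_bool_le1//.
- move=> z; apply: cvgM; first exact: cvg_cst.
  have := @cvg_sin_neg R (al - z.2); rewrite subr_lt0.
  have E n : (zf n.+1%:R^-1 z < 2^-1) = (sin (n.+1%:R^-1 * (al - z.2)) < 0).
    by rewrite /zf; apply/idP/idP; lra.
  by under eq_fun do rewrite -E.
Qed.

Lemma fourier_laplace_inj : ae_eq mu2 setT (EFin \o h) (cst 0%E).
Proof.
have GE : @measurable _ mR = <<s @RGenOInfty.G R >>
  by exact: RGenOInfty.measurableE.
have GI : setI_closed (@RGenOInfty.G R).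
  move=> _ _ [x ->] [y ->]; exists (Num.max x y); apply/seteqP; split => r /=;
    rewrite !in_itv/= !andbT gt_max.
    by move=> [-> ->].
  by move=> /andP[].
have mfst (A : set mR) : measurable A -> measurable (fst @^-1` A : set T).
  by move=> mA; rewrite -[X in measurable X]setTI; exact: measurable_fst.
have msnd (A : set mR) : measurable A -> measurable (snd @^-1` A : set T).
  by move=> mA; rewrite -[X in measurable X]setTI; exact: measurable_snd.
have mray (a : R) : measurable (`]a, +oo[%classic : set mR).
  exact: measurable_itv.
(* Fixing one side of a rectangle amounts to cutting [h] off outside it; the Dynkin argument is then
   run for the cut-off function in the other coordinate. *)
have patch_integral (S A : set T) :
    (\int[mu2]_(z in S) ((h \_ A) z)%:E = \int[mu2]_(z in S `&` A) (h z)%:E)%E.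
  rewrite [RHS]integral_mkcondr; apply: eq_integral => z _.
  by rewrite patchE [RHS]patchE; case: ifP.
have ipatch (A : set T) : measurable A ->
  mu2.-integrable setT (EFin \o (h \_ A)).
  move=> mA; rewrite -restrict_EFin; apply/(integrable_mkcond _ mA).
  exact: integrableS ih.
have rectE (a al : R) :
    (\int[mu2]_(z in snd @^-1` `]al, +oo[%classic `&` fst @^-1` `]a, +oo[%classic)
       (h z)%:E = 0)%E.
  have [_ _ <-] := ann_rectangle a al; rewrite [LHS]integral_mkcond.
  apply: eq_integral => z _; rewrite patchE; case: ifPn.
    by rewrite inE => -[/=]; rewrite !in_itv/= !andbT => -> ->; rewrite !mul1r.
  rewrite notin_setE => /= /not_andP; rewrite !in_itv/= !andbT.
  by move=> [|] /negP/negbTE ->; rewrite ?mulr0 ?mul0r.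
have rayE (a : R) : (\int[mu2]_(z in fst @^-1` `]a, +oo[%classic) (h z)%:E =
  0)%E.
  have [_ _ <-] := ann_ray_cos a 0 0; rewrite [LHS]integral_mkcond.
  apply: eq_integral => z _; rewrite patchE mul0r addr0 cos0 mulr1; case: ifPn.
    by rewrite inE /= in_itv/= andbT => ->; rewrite mul1r.
  by rewrite notin_setE /= in_itv/= andbT => /negP/negbTE ->; rewrite mul0r.
have step1 (a : R) (B : set mR) : measurable B ->
    (\int[mu2]_(z in snd @^-1` B `&` fst @^-1` `]a, +oo[%classic) (h z)%:E =
      0)%E.
  move=> mB; rewrite -patch_integral.
  apply: (dynkin_integral0 _ _ GE GI) => //.
  - by apply: ipatch; exact: mfst.
  - by rewrite patch_integral setTI.
  - by move=> _ [al ->]; rewrite patch_integral.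
have step2 (A B : set mR) : measurable A -> measurable B ->
    (\int[mu2]_(z in fst @^-1` A `&` snd @^-1` B) (h z)%:E = 0)%E.
  move=> mA mB; rewrite -patch_integral.
  apply: (dynkin_integral0 _ _ GE GI) => //.
  - by apply: ipatch; exact: msnd.
  (* The whole strip reduces to the ray of positive masses, since [h] vanishes on the rest. *)
  - rewrite patch_integral setTI -(step1 0 B mB) [RHS]integral_mkcondr.
    apply: eq_integral => z _; rewrite patchE; case: ifPn => //.
    by rewrite notin_setE /= in_itv/= andbT => /negP;
      rewrite -leNgt => /h_supp ->.
  - by move=> _ [a ->]; rewrite patch_integral setIC step1.
apply: integral_ae_eq => //.
move=> E _ mE; rewrite integral_cst// mul0e.
apply: (@dynkin_integral0 _ T R mu2 h ih _ T id
  [set A `*` B | A in measurable & B in measurable]) => //.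
- exact: measurable_prod_measurableType.
- move=> _ _ [A mA [B mB <-]] [A' mA' [B' mB' <-]].
  exists (A `&` A'); first exact: measurableI.
  by exists (B `&` B'); [exact: measurableI|rewrite setXI].
- by have := step2 setT setT measurableT measurableT;
    rewrite !preimage_setT setIT.
- by move=> _ [A mA [B mB <-]]; exact: step2.
Qed.

End uniqueness.

Lemma integrable_EFinZl d (T : measurableType d) (R : realType)
    (m : {measure set T -> \bar R}) (D : set T) (a : R) (f : T -> R) :
  measurable D -> m.-integrable D (EFin \o f) ->
  m.-integrable D (EFin \o (fun x => a * f x)).
Proof.
move=> mD /(integrableZl mD a); exact: eq_integrable.
Qed.

(** * Convolution *)

Section real_fubini.
Context d1 d2 (T1 : measurableType d1) (T2 : measurableType d2) (R : realType).
Variables (m1 : {sigma_finite_measure set T1 -> \bar R}).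
Variables (m2 : {sigma_finite_measure set T2 -> \bar R}).
Variable F : T1 * T2 -> R.
Hypothesis iF : (m1 \x m2)%E.-integrable setT (EFin \o F).

(** The real-valued integral replaces an infinite value by 0. Integrability of [F] confines this to
    a null set of sections, so real and extended iterated integrals agree. *)
Let fineF1 : {ae m1, forall x, (\int[m2]_y F (x, y))%:E =
  (\int[m2]_y (F (x, y))%:E)%E}.
Proof.
apply: filterS (ae_integrable1 iF) => x ix.
by rewrite fineK//; exact: integrable_fin_num.
Qed.

Let fineF2 : {ae m2, forall y, (\int[m1]_x F (x, y))%:E =
  (\int[m1]_x (F (x, y))%:E)%E}.
Proof.
apply: filterS (ae_integrable2 iF) => x ix.
by rewrite fineK//; exact: integrable_fin_num.
Qed.

Lemma measurable_Rintegral1 :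
  measurable_fun setT (fun x => \int[m2]_y F (x, y)).
Proof.
apply: (@measurableT_comp _ _ _ _ _ _ fine) => //.
exact: (measurable_fubini_F iF).
Qed.

Lemma measurable_Rintegral2 :
  measurable_fun setT (fun y => \int[m1]_x F (x, y)).
Proof.
apply: (@measurableT_comp _ _ _ _ _ _ fine) => //.
exact: (measurable_fubini_G iF).
Qed.

Lemma integrable_Rintegral1 :
  m1.-integrable setT (fun x => (\int[m2]_y F (x, y))%:E).
Proof.
apply/integrableP; split; first exact/measurable_EFinP/measurable_Rintegral1.
have /integrableP[mG] := integrable_fubini_F iF.
apply: le_lt_trans; rewrite le_eqVlt; apply/orP; left; apply/eqP.
apply: ae_eq_integral => //.
- by apply: measurableT_comp => //;
    exact/measurable_EFinP/measurable_Rintegral1.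
- exact: measurableT_comp.
- by apply: filterS fineF1 => x -> _.
Qed.

Lemma Rintegral12_prod :
  \int[m1]_x \int[m2]_y F (x, y) = \int[(m1 \x m2)%E]_z F z.
Proof.
congr fine; rewrite -[RHS](integral12_prod_meas1 iF);
  apply: ae_eq_integral => //.
- exact/measurable_EFinP/measurable_Rintegral1.
- exact: (measurable_fubini_F iF).
- by apply: filterS fineF1 => x -> _.
Qed.

Lemma Rintegral21_prod :
  \int[m2]_y \int[m1]_x F (x, y) = \int[(m1 \x m2)%E]_z F z.
Proof.
congr fine; rewrite -[RHS](integral21_prod_meas1 iF);
  apply: ae_eq_integral => //.
- exact/measurable_EFinP/measurable_Rintegral2.
- exact: (measurable_fubini_G iF).
- by apply: filterS fineF2 => x -> _.
Qed.

End real_fubini.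

Section leb2_sigma_finite.
Context {R : realType}.
Local Notation mR := (measurableTypeR R).
Local Notation T := (measurableTypeR R * measurableTypeR R)%type.

Lemma leb2_sigma_finite : sigma_finite setT (leb2 R : set T -> \bar R).
Proof.
have /sigma_finiteP[F [TF ndF Foo]] := sigma_finiteT (@lebesgue_measure R).
exists (fun n => F n `*` F n).
  rewrite -setXTT TF; apply/seteqP; split=> [[x y] [/= [n _ Fx] [k _ Fy]]|].
    exists (maxn n k) => //; split => /=.
      by move: x Fx; exact/subsetPset/ndF/leq_maxl.
    by move: y Fy; exact/subsetPset/ndF/leq_maxr.
  by move=> [x y] [n _ [/= ? ?]]; split; exists n.
move=> n; have [mFn Fn] := Foo n; split; first exact: measurableX.
by rewrite product_measure1E// lte_mul_pinfty// ge0_fin_numE.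
Qed.

End leb2_sigma_finite.

(* The library's canonical sigma-finiteness of a product measure is only found
   for products of subprobabilities, whence this explicit packing. *)
Definition lebT (R : realType) :
    {sigma_finite_measure set (measurableTypeR R * measurableTypeR R)%type ->
      \bar R} :=
  HB.pack (leb2 R) (Measure_isSigmaFinite.Build _ _ _ (leb2 R)
    leb2_sigma_finite).

Section convolution.
Context {R : realType}.
Local Notation mR := (measurableTypeR R).
Local Notation T := (measurableTypeR R * measurableTypeR R)%type.
Local Notation mu2 := (lebT R).
Local Notation L1 u := (mu2.-integrable setT (EFin \o u)).

Definition sub2 (z w : T) : T := ((z.1 : R) - w.1, (z.2 : R) - w.2).

Lemma sub2E w : sub2 ^~ w = affine2 1 1 (- w.1) (- w.2).
Proof. by apply/funext => z; rewrite /sub2 /affine2 !mul1r. Qed.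

Lemma measurable_sub2 : measurable_fun setT (fun zw : T * T => sub2 zw.1 zw.2).
Proof.
apply/measurable_fun_pairP; split => /=; rewrite /sub2.
  apply: (@measurable_funB _ (T * T)%type R setT (fun x => x.1.1)
    (fun x => x.2.1)).
    exact: (measurableT_comp measurable_fst_leb2 measurable_fst).
  exact: (measurableT_comp measurable_fst_leb2 measurable_snd).
apply: (@measurable_funB _ (T * T)%type R setT (fun x => x.1.2)
  (fun x => x.2.2)).
  exact: (measurableT_comp measurable_snd_leb2 measurable_fst).
exact: (measurableT_comp measurable_snd_leb2 measurable_snd).
Qed.

Lemma ge0_integral_sub2 w (F : T -> \bar R) :
  measurable_fun setT F -> (forall z, 0 <= F z)%E ->
  (\int[mu2]_z F (sub2 z w) = \int[mu2]_z F z)%E.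
Proof.
move=> mF F0.
have := @ge0_integral_affine2 R 1 1 (- w.1) (- w.2) F ltr01 ltr01 mF F0.
by rewrite mulr1 invr1 mul1e -sub2E.
Qed.

Lemma Rintegral_sub2 w (u : T -> R) : L1 u ->
  \int[mu2]_z u (sub2 z w) = \int[mu2]_z u z.
Proof.
move=> iu; congr fine.
have := @integral_affine2 R 1 1 (- w.1) (- w.2) (EFin \o u) ltr01 ltr01 iu.
by rewrite mulr1 invr1 mul1e -sub2E.
Qed.

Lemma integrable_sub2 w (u : T -> R) : L1 u -> L1 (fun z => u (sub2 z w)).
Proof.
move=> iu.
have := @integrable_affine2 R 1 1 (- w.1) (- w.2) (EFin \o u) ltr01 ltr01 iu.
by rewrite -sub2E.
Qed.

Definition conv (u v : T -> R) (z : T) : R :=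
  \int[mu2]_w (u (sub2 z w) * v w).

Definition norm1 (u : T -> R) : R := \int[mu2]_z `|u z|.

Lemma norm1_ge0 u : 0 <= norm1 u.
Proof. exact: Rintegral_ge0. Qed.

Lemma norm1E u : L1 u -> (\int[mu2]_z `|u z|%:E = (norm1 u)%:E)%E.
Proof.
move=> iu; rewrite fineK//; apply: integrable_fin_num => //.
exact: integrable_norm.
Qed.

Lemma measurable_L1 u : L1 u -> measurable_fun setT u.
Proof. by move=> /measurable_int/measurable_EFinP. Qed.

Section conv_two.
Variables u v : T -> R.
Hypothesis (iu : L1 u) (iv : L1 v).

Lemma measurable_conv_kernel :
  measurable_fun setT (fun zw : T * T => u (sub2 zw.1 zw.2) * v zw.2).
Proof.
apply: measurable_funM.
  exact: (measurableT_comp (measurable_L1 iu) measurable_sub2).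
exact: (measurableT_comp (measurable_L1 iv) measurable_snd).
Qed.

(** Integrating in [z] first lets translation invariance extract [norm1 u] for every fixed [w]. *)
Lemma norm_conv_kernel :
  (\int[mu2]_w \int[mu2]_z `|u (sub2 z w) * v w|%:E =
   (norm1 u * norm1 v)%:E)%E.
Proof.
under eq_integral => w _.
  under eq_integral => z _ do rewrite normrM mulrC EFinM.
  rewrite ge0_integralZl//; last first.
    apply/measurable_EFinP; apply: measurableT_comp => //.
    exact: measurable_L1 (integrable_sub2 w iu).
  rewrite (@ge0_integral_sub2 w (fun z => `|u z|%:E))//; last first.
    by apply/measurable_EFinP; apply: measurableT_comp => //;
      exact: measurable_L1.
  rewrite norm1E// muleC; over.
rewrite ge0_integralZl//.
- by rewrite norm1E.
- by apply/measurable_EFinP; apply: measurableT_comp => //;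
    exact: measurable_L1.
- by rewrite lee_fin norm1_ge0.
Qed.

Lemma integrable_conv_kernel :
  (mu2 \x mu2)%E.-integrable setT
    (fun zw : T * T => (u (sub2 zw.1 zw.2) * v zw.2)%:E).
Proof.
apply/integrable21ltyP.
  by apply/measurable_EFinP; exact: measurable_conv_kernel.
by rewrite /= norm_conv_kernel ltry.
Qed.

Lemma integrable_conv : L1 (conv u v).
Proof. exact: (integrable_Rintegral1 integrable_conv_kernel). Qed.

Lemma norm1_conv : norm1 (conv u v) <= norm1 u * norm1 v.
Proof.
rewrite -lee_fin -norm1E; last exact: integrable_conv.
rewrite -norm_conv_kernel.
have mK : measurable_fun setT
  (fun zw : T * T => `|u (sub2 zw.1 zw.2) * v zw.2|%:E).
  by apply/measurable_EFinP; apply: measurableT_comp => //;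
    exact: measurable_conv_kernel.
rewrite -(fubini_tonelli (fun zw : T * T =>
  `|u (sub2 zw.1 zw.2) * v zw.2|%:E)%E)//.
apply: ge0_le_integral => //.
- by apply/measurable_EFinP; apply: measurableT_comp => //;
    exact: measurable_L1 integrable_conv.
- exact: (measurable_fun_fubini_tonelli_F _ mK).
move=> z _; apply: (@le_trans _ _ `|\int[mu2]_w (u (sub2 z w) * v w)%:E|%E);
  last first.
  apply: le_abse_integral => //; apply/measurable_EFinP.
  exact: (measurableT_comp measurable_conv_kernel (pair1_measurable z)).
(* Where the extended integral is infinite, [conv] takes the default value 0 and the bound is
   [+oo]. *)
by rewrite /conv /Rintegral; case: (\int[_]_(_ in _) _)%E => [r| |]//=;
  rewrite ?normr0 ?leey.
Qed.

Lemma ae_integrable_conv_kernel :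
  {ae mu2, forall z, L1 (fun w => u (sub2 z w) * v w)}.
Proof. exact: (ae_integrable1 integrable_conv_kernel). Qed.

Definition add2 (z w : T) : T := ((z.1 : R) + w.1, (z.2 : R) + w.2).

Lemma sub2K z w : add2 (sub2 z w) w = z.
Proof. by case: z => x y; rewrite /add2 /sub2 /= !subrK. Qed.

Lemma measurable_add2 w : measurable_fun setT (add2 ^~ w).
Proof.
rewrite (_ : add2 ^~ w = affine2 1 1 w.1 w.2); first exact: measurable_affine2.
by apply/funext => z; rewrite /affine2 !mul1r.
Qed.

(** Fubini and a translation reduce any test of a convolution to the values [k (add2 z w)], which
    split when [k] is built from exponentials and trigonometric functions. *)
Lemma conv_pairing (k : T -> R) M :
  measurable_fun setT k -> (forall z, `|k z| <= M) ->
  \int[mu2]_z (k z * conv u v z) =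
  \int[mu2]_w (v w * \int[mu2]_z (k (add2 z w) * u z)).
Proof.
move=> mk bk.
pose K (zw : T * T) := k zw.1 * (u (sub2 zw.1 zw.2) * v zw.2).
have iK : (mu2 \x mu2)%E.-integrable setT (EFin \o K).
  apply: (@integrable_bounded_mul _ _ _ _ _ integrable_conv_kernel
    (fun zw => k zw.1) M) => //.
  exact: measurableT_comp.
transitivity (\int[mu2]_z \int[mu2]_w K (z, w)).
  congr fine; apply: ae_eq_integral => //.
  - apply/measurable_EFinP; apply: measurable_funM => //.
    exact: measurable_L1 integrable_conv.
  - exact: measurable_int (integrable_Rintegral1 iK).
  - apply: filterS ae_integrable_conv_kernel => z iz _.
    by rewrite /K/= RintegralZl.
rewrite (Rintegral12_prod iK) -(Rintegral21_prod iK).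
apply: eq_Rintegral => w _; rewrite /K/=.
have iku : L1 (fun z => k (add2 z w) * u z).
  apply: (@integrable_bounded_mul _ _ _ _ _ iu (fun z => k (add2 z w)) M) => //.
  by apply: (measurableT_comp mk); exact: measurable_add2.
rewrite -(Rintegral_sub2 w iku) -RintegralZl//;
  last exact: (integrable_sub2 w iku).
by apply: eq_Rintegral => z _; rewrite sub2K; ring.
Qed.

End conv_two.

Lemma ae_conv_linr (a : R) (u v1 v2 : T -> R) : L1 u -> L1 v1 -> L1 v2 ->
  {ae mu2, forall z, conv u (fun w => a * v1 w + v2 w) z = a * conv u v1 z +
    conv u v2 z}.
Proof.
move=> iu iv1 iv2.
apply: filterS2 (ae_integrable_conv_kernel iu iv1)
  (ae_integrable_conv_kernel iu iv2) => z i1 i2.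
rewrite /conv -RintegralZl// -RintegralD//; last exact: integrable_EFinZl.
by apply: eq_Rintegral => w _; ring.
Qed.

(** At a nonpositive mass [z.1], every [w] has [w.1] or [z.1 - w.1] nonpositive, so the integrand
    vanishes identically and the conclusion holds at every point. *)
Lemma conv_supp (u v : T -> R) :
  (forall z : T, (z.1 : R) <= 0 -> u z = 0) ->
    (forall z : T, (z.1 : R) <= 0 -> v z = 0) ->
  forall z : T, (z.1 : R) <= 0 -> conv u v z = 0.
Proof.
move=> su sv z z0; rewrite /conv; under eq_Rintegral => w _.
  have -> : u (sub2 z w) * v w = 0.
    have [/sv ->|w0] := leP (w.1 : R) 0; first by rewrite mulr0.
    by rewrite su ?mul0r//=; lra.
  over.
by rewrite /Rintegral integral0.
Qed.

(** For [u] vanishing at nonpositive masses, [tcos] is the real part and [tsin] minus the imaginary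
    part of its Fourier-Laplace transform. *)
Definition tcos (zeta xi : R) (u : T -> R) :=
  \int[mu2]_z (lkernel zeta z.1 * cos (xi * z.2) * u z).

Definition tsin (zeta xi : R) (u : T -> R) :=
  \int[mu2]_z (lkernel zeta z.1 * sin (xi * z.2) * u z).

(** * Transforms of convolutions *)

Section transform.
Variables (zeta xi : R).
Hypothesis zeta0 : 0 < zeta.

Let kcos (z : T) := lkernel zeta z.1 * cos (xi * z.2).
Let ksin (z : T) := lkernel zeta z.1 * sin (xi * z.2).

Lemma measurable_kcos : measurable_fun setT kcos.
Proof.
apply: measurable_funM; first exact: measurable_lkernel.
by have := measurable_cos_affine xi 0; under eq_fun do rewrite addr0.
Qed.

Lemma measurable_ksin : measurable_fun setT ksin.
Proof.
apply: measurable_funM; first exact: measurable_lkernel.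
have := measurable_cos_affine xi (- (pi / 2)).
by under eq_fun do rewrite cosBpihalf.
Qed.

Lemma kcos_le1 z : `|kcos z| <= 1.
Proof.
by rewrite normrM mulr_ile1 ?norm_cos_le1// ger0_norm ?lkernel_ge0//
  lkernel_le1// ltW.
Qed.

Lemma ksin_le1 z : `|ksin z| <= 1.
Proof.
by rewrite normrM mulr_ile1 ?norm_sin_le1// ger0_norm ?lkernel_ge0//
  lkernel_le1// ltW.
Qed.

Lemma integrable_kcos u : L1 u -> L1 (fun z => kcos z * u z).
Proof. by move=> iu; exact:
  (integrable_bounded_mul iu measurable_kcos kcos_le1). Qed.

Lemma integrable_ksin u : L1 u -> L1 (fun z => ksin z * u z).
Proof. by move=> iu; exact:
  (integrable_bounded_mul iu measurable_ksin ksin_le1). Qed.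

Lemma tcos_lin a u v : L1 u -> L1 v ->
  tcos zeta xi (fun z => a * u z + v z) = a * tcos zeta xi u + tcos zeta xi v.
Proof.
move=> iu iv; have [ku kv] := (integrable_kcos iu, integrable_kcos iv).
rewrite /tcos -RintegralZl// -RintegralD//; last exact: integrable_EFinZl.
by apply: eq_Rintegral => z _; ring.
Qed.

Lemma tsin_lin a u v : L1 u -> L1 v ->
  tsin zeta xi (fun z => a * u z + v z) = a * tsin zeta xi u + tsin zeta xi v.
Proof.
move=> iu iv; have [ku kv] := (integrable_ksin iu, integrable_ksin iv).
rewrite /tsin -RintegralZl// -RintegralD//; last exact: integrable_EFinZl.
by apply: eq_Rintegral => z _; ring.
Qed.

Lemma lkernelD (x y : R) : 0 < x -> 0 < y ->
  lkernel zeta (x + y) = lkernel zeta x * lkernel zeta y.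
Proof.
move=> x0 y0; rewrite /lkernel !max_l ?addr_ge0 ?ltW// -expRD.
by congr expR; ring.
Qed.

Variables u v : T -> R.
Hypothesis (iu : L1 u) (iv : L1 v).
Hypothesis su : forall z : T, (z.1 : R) <= 0 -> u z = 0.
Hypothesis sv : forall z : T, (z.1 : R) <= 0 -> v z = 0.

(** This is the real part of the product of the two complex transforms; [tsin_conv] is the imaginary
    part up to sign. The truncated kernel is multiplicative on positive masses only, whence the
    support conditions on [u] and [v]. *)
Lemma tcos_conv : tcos zeta xi (conv u v) =
  tcos zeta xi u * tcos zeta xi v - tsin zeta xi u * tsin zeta xi v.
Proof.
have [cu cv] := (integrable_kcos iu, integrable_kcos iv).
have [du dv] := (integrable_ksin iu, integrable_ksin iv).
rewrite /tcos (conv_pairing iu iv measurable_kcos kcos_le1).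
rewrite /tsin -RintegralZl// -[X in _ - X]RintegralZl// -RintegralB//;
  last 2 first.
- exact: integrable_EFinZl.
- exact: integrable_EFinZl.
apply: eq_Rintegral => w _; rewrite /kcos /=.
have [/sv ->|w0] := leP (w.1 : R) 0; first by rewrite !mulr0 mul0r subr0.
have -> : \int[mu2]_z (lkernel zeta ((z.1 : R) + w.1) * cos
  (xi * ((z.2 : R) + w.2)) * u z) =
  \int[mu2]_z (kcos w * (kcos z * u z) - ksin w * (ksin z * u z)).
  apply: eq_Rintegral => z _.
  have [/su ->|z0] := leP (z.1 : R) 0; first by rewrite !mulr0 subr0.
  by rewrite lkernelD// mulrDr cosD /kcos /ksin; ring.
rewrite RintegralB//; last 2 first.
- exact: integrable_EFinZl.
- exact: integrable_EFinZl.
by rewrite !RintegralZl// /kcos /ksin; ring.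
Qed.

Lemma tsin_conv : tsin zeta xi (conv u v) =
  tsin zeta xi u * tcos zeta xi v + tcos zeta xi u * tsin zeta xi v.
Proof.
have [cu cv] := (integrable_kcos iu, integrable_kcos iv).
have [du dv] := (integrable_ksin iu, integrable_ksin iv).
rewrite /tsin (conv_pairing iu iv measurable_ksin ksin_le1).
rewrite /tcos -RintegralZl// -[X in _ + X]RintegralZl// -RintegralD//;
  last 2 first.
- exact: integrable_EFinZl.
- exact: integrable_EFinZl.
apply: eq_Rintegral => w _; rewrite /ksin /=.
have [/sv ->|w0] := leP (w.1 : R) 0; first by rewrite !mulr0 mul0r addr0.
have -> : \int[mu2]_z (lkernel zeta ((z.1 : R) + w.1) * sin
  (xi * ((z.2 : R) + w.2)) * u z) =
  \int[mu2]_z (kcos w * (ksin z * u z) + ksin w * (kcos z * u z)).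
  apply: eq_Rintegral => z _.
  have [/su ->|z0] := leP (z.1 : R) 0; first by rewrite !mulr0 addr0.
  by rewrite lkernelD// mulrDr sinD /kcos /ksin; ring.
rewrite RintegralD//; last 2 first.
- exact: integrable_EFinZl.
- exact: integrable_EFinZl.
by rewrite !RintegralZl// /kcos /ksin; ring.
Qed.

End transform.
End convolution.

(** * Zero extension and collision terms *)

Section real_integral_extra.
Context d (T : measurableType d) (R : realType) (m : {measure set T -> \bar R}).

Lemma integrable_ae_eq (D : set T) (f g : T -> \bar R) :
  measurable D -> measurable_fun D f -> m.-integrable D g -> ae_eq m D f g ->
  m.-integrable D f.
Proof.
move=> mD mf ig fg; apply/integrableP; split=> //.
have /integrableP[mg] := ig; apply: le_lt_trans.
rewrite le_eqVlt; apply/orP; left; apply/eqP.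
apply: ae_eq_integral => //; [exact: measurableT_comp|exact: measurableT_comp|].
by apply: filterS fg => x fg Dx; rewrite fg.
Qed.

Lemma ae_eq_Rintegral (D : set T) (f g : T -> R) :
  measurable D -> measurable_fun D f -> measurable_fun D g ->
  {ae m, forall x, D x -> f x = g x} ->
  \int[m]_(x in D) f x = \int[m]_(x in D) g x.
Proof.
move=> mD mf mg fg; congr fine; apply: ae_eq_integral => //.
- exact/measurable_EFinP.
- exact/measurable_EFinP.
- by apply: filterS fg => x fg Dx; rewrite fg.
Qed.

End real_integral_extra.

(** Tonelli applies to the positive and negative parts separately, so sections with a meaningless
    integral do no harm. The gain term calls for this, as its kernel is integrable for almost every
    point only. *)
Lemma measurable_Rintegral d1 d2 (T1 : measurableType d1)
    (T2 : measurableType d2) (R : realType)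
    (m : {sigma_finite_measure set T2 -> \bar R}) (F : T1 * T2 -> R) :
  measurable_fun setT F -> measurable_fun setT (fun x => \int[m]_y F (x, y)).
Proof.
move=> /measurable_EFinP mF; apply: (@measurableT_comp _ _ _ _ _ _ fine) => //.
rewrite (_ : (fun _ => _) = (fun x => \int[m]_y (EFin \o F)^\+ (x, y)) \-
   (fun x => \int[m]_y (EFin \o F)^\- (x, y)))%E.
  apply: emeasurable_funB.
    by apply: measurable_fun_fubini_tonelli_F => //; exact: measurable_funepos.
  by apply: measurable_fun_fubini_tonelli_F => //; exact: measurable_funeneg.
apply/funext => x.
rewrite [LHS](_ : _ = \int[m]_y ((EFin \o F) (x, y)))%E// [LHS]integralE.
under eq_integral do rewrite funepos_comp/=.
by under [X in (_ - X)%E = _]eq_integral do rewrite funeneg_comp/=.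
Qed.

Section zero_extension.
Context {R : realType}.
Local Notation mR := (measurableTypeR R).
Local Notation T := (measurableTypeR R * measurableTypeR R)%type.
Local Notation mu := (@lebesgue_measure R).
Local Notation mu2 := (lebT R).
Local Notation L1 u := (mu2.-integrable setT (EFin \o u)).

(** Extension by zero turns the gain, an integral over a domain depending on [m], into a convolution
    on the group of the whole plane. *)
Definition ext (u : R -> R -> R) (z : T) : R :=
  if 0 < (z.1 : R) then u z.1 z.2 else 0.

Lemma ext_supp u (z : T) : (z.1 : R) <= 0 -> ext u z = 0.
Proof. by rewrite /ext leNgt => /negbTE ->. Qed.

Lemma ext_pos u (z : T) : 0 < (z.1 : R) -> ext u z = u z.1 z.2.
Proof. by rewrite /ext => ->. Qed.

Lemma in_phase (z : R * R) : phase R z <-> 0 < z.1.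
Proof. by rewrite /phase /= in_itv/= andbT; split=> [[]|]. Qed.

Lemma measurable_phase : measurable (phase R : set T).
Proof. by apply: measurableX => //; exact: measurable_itv. Qed.

Lemma ext_patch u : EFin \o ext u = (fun z : T => (u z.1 z.2)%:E) \_ (phase R).
Proof.
apply/funext => z; rewrite patchE /= /ext.
case: ifPn => z0; first by rewrite mem_set//; exact/in_phase.
by rewrite memNset// => /in_phase; exact/negP.
Qed.

Lemma in_L1P u : in_L1 u <-> L1 (ext u).
Proof.
rewrite ext_patch; split => [iu|iu].
  by apply/(integrable_mkcond _ measurable_phase).
by apply/(integrable_mkcond _ measurable_phase).
Qed.

Lemma laplace_fourierE u (zeta xi : R) : 0 < zeta -> in_L1 u ->
  laplace (fun y => fourier (u y) xi) zeta =
  Complex (tcos zeta xi (ext u)) (- tsin zeta xi (ext u)).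
Proof.
move=> z0 /in_L1P iu; rewrite /laplace.
(* Cosine and sine are handled together; the scalar [a] absorbs the sign of the imaginary part. *)
have main (a : R) (c : R -> R) : measurable_fun setT (fun z : T => c z.2) ->
  (forall z, `|c z| <= 1) ->
    \int[mu]_(y in `]0%R, +oo[)
      (expR (- (zeta * y)) * (a * \int[mu]_x (c x * u y x))) =
    a * \int[mu2]_z (lkernel zeta z.1 * c z.2 * ext u z).
  move=> mc c1.
  have ic : L1 (fun z : T => c z.2 * ext u z).
    by apply: (@integrable_bounded_mul _ _ _ _ _ iu (fun z : T => c z.2) 1).
  have ik : L1 (fun z : T => lkernel zeta z.1 * (c z.2 * ext u z)).
    apply: (@integrable_bounded_mul _ _ _ _ _ ic (fun z : T => lkernel zeta z.1)
      1) => //.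
      exact: measurable_lkernel.
    by move=> z; rewrite ger0_norm ?lkernel_ge0// lkernel_le1// ltW.
  have mI : measurable_fun setT (fun y : mR => \int[mu]_x (c x * ext u (y, x))).
    exact: (measurable_Rintegral1 ic).
  transitivity (\int[mu]_y (a *
    (lkernel zeta y * \int[mu]_x (c x * ext u (y, x))))).
    rewrite Rintegral_mkcond; apply: eq_Rintegral => y _.
    rewrite patchE; case: ifPn; last first.
      rewrite notin_setE /= in_itv/= andbT => /negP; rewrite -leNgt => y0.
      under [in RHS]eq_Rintegral do rewrite ext_supp// mulr0.
      by rewrite /Rintegral integral0 mulr0 mulr0.
    rewrite inE /= in_itv/= andbT => y0; rewrite mulrCA.
    rewrite /lkernel max_l ?ltW//; congr (_ * (_ * _)).
    by apply: eq_Rintegral => x _; rewrite ext_pos.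
  transitivity (a * \int[mu2]_z (lkernel zeta z.1 * (c z.2 * ext u z)));
    last first.
    by congr (_ * _); apply: eq_Rintegral => z _; rewrite mulrA.
  rewrite -(Rintegral12_prod ik) -RintegralZl//;
    last exact: (integrable_Rintegral1 ik).
  have mlk : measurable_fun setT (fun y : mR => lkernel zeta y).
    exact: (measurableT_comp (measurable_lkernel zeta)
      (pair2_measurable (0 : mR))).
  (* The Laplace factor enters the inner integral only where the section is integrable, that is for
     almost every [y]. *)
  apply: ae_eq_Rintegral => //.
  - by apply: measurable_funM => //; exact: measurable_funM.
  - by apply: measurable_funM => //; exact: (measurable_Rintegral1 ik).
  - by apply: filterS (ae_integrable1 ic) => y iy _; congr (a * _);
      rewrite -RintegralZl.
congr Complex.
  under eq_Rintegral do rewrite -[X in _ * X]mul1r.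
  rewrite main; [|by have := measurable_cos_affine xi 0;
    under eq_fun do rewrite addr0|by move=> z; exact: norm_cos_le1].
  by rewrite mul1r.
rewrite /= [LHS](_ : _ = \int[mu]_(y in `]0%R, +oo[)
    (expR (- (zeta * y)) * (-1 * \int[mu]_x (sin (xi * x) * u y x))));
      last first.
  by apply: eq_Rintegral => y _; rewrite mulN1r.
rewrite main; [by rewrite mulN1r| |by move=> z; exact: norm_sin_le1].
have := measurable_cos_affine xi (- (pi / 2)).
by under eq_fun do rewrite cosBpihalf.
Qed.

End zero_extension.

(** * The gain as a convolution, the loss through the total mass *)

Section collision.
Context {R : realType}.
Local Notation mR := (measurableTypeR R).
Local Notation T := (measurableTypeR R * measurableTypeR R)%type.
Local Notation mu := (@lebesgue_measure R).
Local Notation mu2 := (lebT R).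
Local Notation L1 u := (mu2.-integrable setT (EFin \o u)).
Variable u : R -> R -> R.
Hypothesis iu : in_L1 u.

Let iU : L1 (ext u). Proof. exact/in_L1P. Qed.

Lemma mass_ext :
  \int[mu]_p \int[mu]_(m in `]0%R, +oo[) u m p = \int[mu2]_z ext u z.
Proof.
rewrite -(Rintegral21_prod iU); apply: eq_Rintegral => p _.
rewrite Rintegral_mkcond; apply: eq_Rintegral => m _; rewrite patchE /ext/=.
case: ifPn; first by rewrite inE /= in_itv/= andbT => ->.
by rewrite notin_setE /= in_itv/= andbT => /negP/negbTE ->.
Qed.

Let ker (zw : T * T) := ext u (sub2 zw.1 zw.2) * ext u zw.2.

Let kerE (z w : T) : (`]0, (z.1 : R)[%classic `*` setT) w ->
  u ((z.1 : R) - w.1) ((z.2 : R) - w.2) * u w.1 w.2 = ker (z, w).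
Proof.
by move=> [/=]; rewrite in_itv/= => /andP[w0 wz] _;
  rewrite /ker !ext_pos//= subr_gt0.
Qed.

(** Since [ext] vanishes at mass 0 as well, both ends of the mass interval are excluded, matching
    the open interval in the gain. *)
Let ker0 (z w : T) : ~ (`]0, (z.1 : R)[%classic `*` setT) w -> ker (z, w) = 0.
Proof.
move=> /= nw; have [w0|w0] := leP (w.1 : R) 0;
  first by rewrite /ker (ext_supp _ w0) mulr0.
rewrite /ker ext_supp ?mul0r//= subr_le0 leNgt; apply/negP => wz; apply: nw;
  split => //=.
by rewrite in_itv/= w0.
Qed.

Lemma collisionE (m p : R) :
  \int[mu]_p' \int[mu]_(m' in `]0%R, m[) (u (m - m') (p - p') * u m' p') =
  \int[mu]_p' \int[mu]_m' (ext u (sub2 (m, p) (m', p')) * ext u (m', p')).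
Proof.
apply: eq_Rintegral => p' _; rewrite Rintegral_mkcond;
  apply: eq_Rintegral => m' _.
rewrite patchE; case: ifPn.
  by rewrite inE => m'm; exact: (@kerE (m, p) (m', p')).
by rewrite notin_setE => m'm; apply/esym/(@ker0 (m, p) (m', p')) => -[].
Qed.

Lemma ae_collision : {ae mu2, forall z : T,
  \int[mu]_p' \int[mu]_(m' in `]0%R, (z.1 : R)[)
    (u ((z.1 : R) - m') ((z.2 : R) - p') * u m' p') =
  conv (ext u) (ext u) z}.
Proof.
apply: filterS (ae_integrable_conv_kernel iU iU) => -[m p] iz.
by rewrite collisionE; exact: (Rintegral21_prod iz).
Qed.

Lemma ae_integrable_collision : {ae mu2, forall z : T, phase R z ->
  mu2.-integrable (`]0, (z.1 : R)[%classic `*` setT)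
    (fun w : T => (u ((z.1 : R) - w.1) ((z.2 : R) - w.2) * u w.1 w.2)%:E)}.
Proof.
apply: filterS (ae_integrable_conv_kernel iU iU) => z iz _.
have mD : measurable (`]0, (z.1 : R)[%classic `*` setT : set T).
  by apply: measurableX => //; exact: measurable_itv.
have := integrableS measurableT mD (@subsetT _ _) iz.
by apply: eq_integrable => // w; rewrite inE => /kerE /= ->.
Qed.

Lemma measurable_collision : measurable_fun setT (fun z : T =>
  \int[mu]_p' \int[mu]_(m' in `]0%R, (z.1 : R)[)
    (u ((z.1 : R) - m') ((z.2 : R) - p') * u m' p')).
Proof.
have mU := measurable_L1 iU.
(* The variable is packed as [((z, p'), m')], so that integrating the last component twice gives the
   gain in its order of integration. *)
pose F (y : (T * mR) * mR) := ker (y.1.1, (y.2, y.1.2)).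
have mF : measurable_fun setT F.
  apply: (measurableT_comp (measurable_conv_kernel iU iU)).
  apply/measurable_fun_pairP; split => /=.
    exact: (measurableT_comp measurable_fst measurable_fst).
  apply/measurable_fun_pairP; split => /=; first exact: measurable_snd.
  exact: (measurableT_comp measurable_snd measurable_fst).
have := measurable_Rintegral mu (measurable_Rintegral mu mF).
congr measurable_fun; apply/funext => -[m p].
by rewrite collisionE.
Qed.

End collision.

(** * The L^1 norm, and injectivity in terms of real integrals *)

Section L1_tools.
Context {R : realType}.
Local Notation T := (measurableTypeR R * measurableTypeR R)%type.
Local Notation mu2 := (lebT R).
Local Notation L1 u := (mu2.-integrable setT (EFin \o u)).

Lemma L1_lin (a : R) (u v : T -> R) : L1 u -> L1 v ->
  L1 (fun z => a * u z + v z).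
Proof.
move=> iu iv; have := integrableD measurableT
  (integrable_EFinZl a measurableT iu) iv.
exact: eq_integrable.
Qed.

Lemma norm1_lin (a : R) (u v : T -> R) : L1 u -> L1 v ->
  norm1 (fun z => a * u z + v z) <= `|a| * norm1 u + norm1 v.
Proof.
move=> iu iv; rewrite /norm1 -RintegralZl//; last exact: integrable_norm.
have inorm w : L1 w -> L1 (fun z => `|w z|) by exact: integrable_norm.
rewrite -RintegralD//; last 2 first.
- by apply: integrable_EFinZl => //; exact: inorm.
- exact: inorm.
apply: le_Rintegral => //.
- by apply: inorm; exact: L1_lin.
- have := @L1_lin `|a| (fun z => `|u z|) (fun z => `|v z|).
  by apply; exact: inorm.
- by move=> z _; rewrite (le_trans (ler_normD _ _))// normrM.
Qed.

Lemma norm1_ae_eq (u v : T -> R) : measurable_fun setT u ->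
  measurable_fun setT v ->
  {ae mu2, forall z, u z = v z} -> norm1 u = norm1 v.
Proof.
move=> mu mv uv; apply: ae_eq_Rintegral => //.
- exact: measurableT_comp.
- exact: measurableT_comp.
- by apply: filterS uv => z ->.
Qed.

Lemma transform_inj (u : T -> R) : L1 u ->
  (forall z : T, (z.1 : R) <= 0 -> u z = 0) ->
  (forall zeta xi, 0 < zeta -> tcos zeta xi u = 0 /\ tsin zeta xi u = 0) ->
  {ae mu2, forall z, u z = 0}.
Proof.
move=> iu su tu.
have zero (I : \bar R) : I \is a fin_num -> fine I = 0 -> I = 0%E.
  by move=> Ifin I0; rewrite -(fineK Ifin) I0.
have := @fourier_laplace_inj R u iu su.
move=> /(_ _)/wrap[].
  move=> zeta xi z0; have [tc ts] := tu zeta xi z0; split.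
    by apply: zero => //; apply: integrable_fin_num => //;
      exact: integrable_kcos.
  by apply: zero => //; apply: integrable_fin_num => //; exact: integrable_ksin.
by apply: filterS => z /(_ I) [].
Qed.

End L1_tools.

(** * The self-similar family *)

Section self_similar_family.
Context {R : realType}.
Local Notation mR := (measurableTypeR R).
Local Notation T := (measurableTypeR R * measurableTypeR R)%type.
Local Notation mu := (@lebesgue_measure R).
Local Notation mu2 := (lebT R).
Local Notation L1 u := (mu2.-integrable setT (EFin \o u)).
Variable g : R -> R -> R.
Hypothesis ig : in_L1 g.

Definition dilate (t m p : R) : R :=
  t `^ (- (5 / 2)) * g (m / t) (p / Num.sqrt t).

Lemma powR_five_halves (t : R) : 0 < t ->
  t `^ (- (5 / 2)) = (t * (t * Num.sqrt t))^-1.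
Proof.
move=> t0; rewrite powRN; congr (_^-1).
have -> : 5 / 2 = 2%:R + 2^-1 :> R by field.
rewrite powRD; last by rewrite (gt_eqF t0) implybT.
by rewrite powR_mulrn ?ltW// powR12_sqrt ?ltW// expr2 mulrA.
Qed.

Section fixed_time.
Variable t : R.
Hypothesis t0 : 0 < t.
Let st0 : 0 < Num.sqrt t. Proof. by rewrite sqrtr_gt0. Qed.
Let A (z : T) : T := affine2 t^-1 (Num.sqrt t)^-1 0 0 z.
Let iG : L1 (ext g). Proof. exact/in_L1P. Qed.

Lemma ext_dilate : ext (dilate t) = fun z => t `^ (- (5 / 2)) * ext g (A z).
Proof.
apply/funext => z; rewrite /ext /A /= addr0 pmulr_rgt0 ?invr_gt0//.
case: ifP => _; last by rewrite mulr0.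
by rewrite /dilate addr0 (mulrC z.1) (mulrC z.2).
Qed.

Let integrable_A (w : T -> R) : L1 w -> L1 (w \o A).
Proof.
by move=> iw; apply: (integrable_affine2 0 0 _ _ iw); rewrite invr_gt0.
Qed.

(** The Jacobian [t * Num.sqrt t] accounts for 3/2 of the exponent 5/2 and leaves [t^-1]. *)
Lemma Rintegral_dilate (w : T -> R) : L1 w ->
  \int[mu2]_z (t `^ (- (5 / 2)) * w (A z)) = t^-1 * \int[mu2]_z w z.
Proof.
move=> iw; rewrite RintegralZl//; last exact: integrable_A.
have -> : \int[mu2]_z w (A z) = (t * Num.sqrt t) * \int[mu2]_z w z.
  rewrite /Rintegral.
  have := @integral_affine2 R t^-1 (Num.sqrt t)^-1 0 0 (EFin \o w) _ _ iw.
  rewrite !invr_gt0 => /(_ t0 st0) ->.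
  rewrite fineM//; last exact: integrable_fin_num.
  by rewrite -invfM invrK.
rewrite powR_five_halves//; move: (\int[mu2]_z w z) => I.
by field; rewrite !gt_eqF.
Qed.

Lemma L1_dilate : L1 (ext (dilate t)).
Proof. by rewrite ext_dilate; apply: integrable_EFinZl => //;
  exact: integrable_A. Qed.

Lemma norm1_dilate : norm1 (ext (dilate t)) = t^-1 * norm1 (ext g).
Proof.
rewrite ext_dilate /norm1 -Rintegral_dilate; last exact: integrable_norm.
by apply: eq_Rintegral => z _; rewrite normrM ger0_norm ?powR_ge0.
Qed.

Lemma mass_dilate : \int[mu2]_z ext (dilate t) z = t^-1 * \int[mu2]_z ext g z.
Proof. by rewrite ext_dilate -Rintegral_dilate. Qed.

Let lkernelA zeta (z : T) : lkernel (t * zeta) (A z).1 = lkernel zeta z.1.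
Proof.
rewrite /lkernel /A /= addr0 -[X in Num.max _ X](mulr0 t^-1).
rewrite -maxr_pMr ?invr_ge0 ?ltW//; congr (expR (- _)).
by rewrite mulrACA mulfV ?gt_eqF// mul1r.
Qed.

Lemma tcos_dilate zeta xi : 0 < zeta ->
  tcos zeta xi (ext (dilate t)) =
    t^-1 * tcos (t * zeta) (Num.sqrt t * xi) (ext g).
Proof.
move=> z0; rewrite ext_dilate /tcos -Rintegral_dilate; last first.
  by apply: integrable_kcos => //; rewrite mulr_gt0.
apply: eq_Rintegral => z _; rewrite lkernelA.
have -> : Num.sqrt t * xi * (A z).2 = xi * z.2.
  by rewrite /A /= addr0 mulrACA mulfV ?gt_eqF// mul1r.
by ring.
Qed.

Lemma tsin_dilate zeta xi : 0 < zeta ->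
  tsin zeta xi (ext (dilate t)) =
    t^-1 * tsin (t * zeta) (Num.sqrt t * xi) (ext g).
Proof.
move=> z0; rewrite ext_dilate /tsin -Rintegral_dilate; last first.
  by apply: integrable_ksin => //; rewrite mulr_gt0.
apply: eq_Rintegral => z _; rewrite lkernelA.
have -> : Num.sqrt t * xi * (A z).2 = xi * z.2.
  by rewrite /A /= addr0 mulrACA mulfV ?gt_eqF// mul1r.
by ring.
Qed.

End fixed_time.

Lemma cvg_tcos_mass : tcos n.+1%:R^-1 0 (ext g) @[n --> \oo] -->
  \int[mu2]_z ext g z.
Proof.
have iG : L1 (ext g) by exact/in_L1P.
have kE n (z : T) : lkernel n.+1%:R^-1 z.1 * cos (0 * z.2) * ext g z =
  lkernel n.+1%:R^-1 z.1 * ext g z.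
  by rewrite mul0r cos0 mulr1.
have ik n : L1 (fun z => lkernel n.+1%:R^-1 z.1 * ext g z).
  have := @integrable_kcos R n.+1%:R^-1 0 _ (ext g) iG.
  move=> /(_ _)/wrap[//|]; apply: eq_integrable => // z _ /=.
  by rewrite kE.
have [] := @dominated_convergence _ T R mu2 setT measurableT
  (fun n z => (lkernel n.+1%:R^-1 z.1 * ext g z)%:E) (EFin \o ext g)
    (abse \o (EFin \o ext g)).
- by move=> n; exact: measurable_int (ik n).
- exact: measurable_int iG.
- apply: aeW => z _; apply: cvg_EFin; first exact: nearW.
  rewrite -[X in _ --> X]mul1r; apply: cvgM;
    [exact: cvg_lkernel|exact: cvg_cst].
- exact: integrable_abse.
- apply: aeW => z n _; rewrite /= lee_fin normrM ler_piMl//.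
  by rewrite ger0_norm ?lkernel_ge0// lkernel_le1.
move=> _ _ cvgI; apply: fine_cvg; rewrite fineK; last exact: integrable_fin_num.
move: cvgI; apply: cvg_trans; apply: near_eq_cvg; apply: nearW => n.
by apply: eq_integral => z _; rewrite kE.
Qed.

End self_similar_family.

(** * The equation in L^1 *)

Section strong.
Context {R : realType}.
Local Notation mR := (measurableTypeR R).
Local Notation T := (measurableTypeR R * measurableTypeR R)%type.
Local Notation mu := (@lebesgue_measure R).
Local Notation mu2 := (lebT R).
Local Notation L1 u := (mu2.-integrable setT (EFin \o u)).
Variables (Phi : R -> R) (g : R -> R -> R).
Hypothesis denom_neq0 : forall zeta xi : R, 0 < zeta ->
  2 * zeta * Phi (xi ^+ 2 / zeta) + 1 != 0.
Hypothesis g_def : is_inverse_fourier_laplace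
  (fun zeta xi => 2 / (2 * zeta * Phi (xi ^+ 2 / zeta) + 1)) g.

Let ig : in_L1 g := g_def.1.
Let f := dilate g.
Let F t := ext (f t).

Let L1_F t : 0 < t -> L1 (F t). Proof. exact: L1_dilate. Qed.
Let in_L1_f t : 0 < t -> in_L1 (f t). Proof. by move=> t0;
  apply/in_L1P/L1_F. Qed.
Let F_supp t (z : T) : (z.1 : R) <= 0 -> F t z = 0. Proof. exact: ext_supp. Qed.

Lemma transform_g zeta xi : 0 < zeta ->
  tcos zeta xi (ext g) = 2 / (2 * zeta * Phi (xi ^+ 2 / zeta) + 1) /\
  tsin zeta xi (ext g) = 0.
Proof.
move=> z0; have := g_def.2 zeta xi z0; rewrite laplace_fourierE// => -[-> /eqP].
by rewrite oppr_eq0 => /eqP ->.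
Qed.

(** The ratio [xi ^+ 2 / zeta] is unchanged by the rescaling of the two variables, so [Phi] is
    evaluated at one and the same point for all times. *)
Lemma transform_F t zeta xi : 0 < t -> 0 < zeta ->
  tcos zeta xi (F t) = 2 / (t * (2 * t * zeta * Phi (xi ^+ 2 / zeta) + 1)) /\
  tsin zeta xi (F t) = 0.
Proof.
move=> t0 z0; have tz0 : 0 < t * zeta by rewrite mulr_gt0.
have [tc ts] := transform_g (Num.sqrt t * xi) tz0.
rewrite /F /f tcos_dilate// tsin_dilate// tc ts mulr0; split => //.
have -> : (Num.sqrt t * xi) ^+ 2 / (t * zeta) = xi ^+ 2 / zeta.
  by rewrite exprMn sqr_sqrtr ?ltW//; field; rewrite !gt_eqF.
by rewrite [in RHS]invfM (mulrA 2 t zeta) mulrCA.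
Qed.

(** On the line [xi = 0] the argument of [Phi] stays at 0, so the denominator tends to 1 with
    [zeta]. *)
Lemma mass_g : \int[mu2]_z ext g z = 2.
Proof.
have c2 : (2 / (2 * n.+1%:R^-1 * Phi 0 + 1) : R) @[n --> \oo] --> (2 : R).
  rewrite -[X in _ --> X]divr1; apply: cvgM; first exact: cvg_cst.
  apply: cvgV => //.
  rewrite -[X in _ --> X]add0r; apply: cvgD; last exact: cvg_cst.
  rewrite -[X in _ --> X](mul0r (Phi 0)); apply: cvgM; last exact: cvg_cst.
  by rewrite -[X in _ --> X](mulr0 2); apply: cvgM;
    [exact: cvg_cst|exact: cvg_harmonic].
have E : (fun n => tcos n.+1%:R^-1 0 (ext g)) =
  fun n : nat => 2 / (2 * n.+1%:R^-1 * Phi 0 + 1).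
  apply/funext => n; have [-> _] := @transform_g n.+1%:R^-1 0 (harmonic_gt0 n).
  by rewrite expr0n/= mul0r.
have := cvg_tcos_mass ig; rewrite E => c1.
exact: (cvg_unique (@Rhausdorff R) c1 c2).
Qed.

Lemma mass_f t : 0 < t ->
  \int[mu]_p \int[mu]_(m in `]0%R, +oo[) f t m p = 2 / t.
Proof.
by move=> t0; rewrite (mass_ext (in_L1_f t0)) mass_dilate// mass_g mulrC.
Qed.

(** The coefficient is s^2 t^2 (1 / (2 t) - 1 / (2 s)), the powers coming from the factors of t^2 f
    at the two times. *)
Lemma resolvent_identity s t : 0 < s -> 0 < t -> {ae mu2, forall z,
  s ^+ 2 * F s z - t ^+ 2 * F t z = t * s * (s - t) / 2 * conv (F t) (F s) z}.
Proof.
move=> s0 t0; have [iFs iFt] := (L1_F s0, L1_F t0).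
have iC := integrable_conv iFt iFs.
have i0 : L1 (fun=> 0 : R) by exact: integrable0.
(* The nested form with a final 0 matches the pattern [a * u + v] of the linearity lemmas. *)
pose h z := - (t * s * (s - t) / 2) * conv (F t) (F s) z +
  (s ^+ 2 * F s z + (- t ^+ 2 * F t z + 0)).
have i1 : L1 (fun z => - t ^+ 2 * F t z + 0) by exact: L1_lin.
have i2 : L1 (fun z => s ^+ 2 * F s z + (- t ^+ 2 * F t z + 0))
  by exact: L1_lin.
have ih : L1 h by exact: L1_lin.
have : {ae mu2, forall z, h z = 0}.
  apply: transform_inj => //.
    move=> z z0; rewrite /h conv_supp//; [|exact: F_supp|exact: F_supp].
    by rewrite !F_supp// !mulr0 !addr0.
  move=> zeta xi z0.
  have [tcs tss] := transform_F xi s0 z0; have [tct tst] :=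
    transform_F xi t0 z0.
  have tc0 : tcos zeta xi (fun=> 0 : R) = 0.
    by rewrite /tcos; under eq_Rintegral do rewrite mulr0;
      rewrite /Rintegral integral0.
  have ts0 : tsin zeta xi (fun=> 0 : R) = 0.
    by rewrite /tsin; under eq_Rintegral do rewrite mulr0;
      rewrite /Rintegral integral0.
  rewrite /h !tcos_lin// !tsin_lin//.
  rewrite (tcos_conv xi z0 iFt iFs (@F_supp t) (@F_supp s)).
  rewrite (tsin_conv xi z0 iFt iFs (@F_supp t) (@F_supp s)).
  rewrite tcs tss tct tst tc0 ts0; split; last by rewrite !(mulr0,mul0r,addr0).
  (* This is the hypothesis on denominators at the rescaled point [(r * zeta, Num.sqrt r * xi)]. *)
  have D r : 0 < r -> 2 * r * zeta * Phi (xi ^+ 2 / zeta) + 1 != 0.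
    move=> r0; have rz0 : 0 < r * zeta by rewrite mulr_gt0.
    have := denom_neq0 (Num.sqrt r * xi) rz0.
    rewrite exprMn sqr_sqrtr ?ltW// mulrA.
    by rewrite (_ : r * xi ^+ 2 / (r * zeta) = xi ^+ 2 / zeta)//; field;
      rewrite !gt_eqF.
  have [Ds Dt] := (D _ s0, D _ t0).
  by field; rewrite Ds Dt !gt_eqF.
apply: filterS => z; rewrite /h; lra.
Qed.

Lemma ae_rhs t : 0 < t -> {ae mu2, forall z : T, phase R z ->
  rhs f t z.1 z.2 = 2^-1 * conv (F t) (F t) z - 2 / t * F t z}.
Proof.
move=> t0; apply: filterS (ae_collision (in_L1_f t0)) => z gE /in_phase z0.
rewrite /rhs /gain gE /loss mass_f// -(ext_pos (f t) z0) -/(F t).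
by rewrite [_ * (2 / t)]mulrC.
Qed.

(** The almost everywhere formula [ae_rhs] does not give this by itself, the product sigma-algebra
    being not complete. *)
Lemma measurable_rhs t : 0 < t ->
  measurable_fun (phase R : set T) (fun z : T => rhs f t z.1 z.2).
Proof.
move=> t0; apply: measurable_funB.
  apply: measurable_funM => //; apply: measurable_funTS.
  exact: measurable_collision (in_L1_f t0).
apply: measurable_funM.
  by apply/measurable_EFinP; exact: measurable_int (in_L1_f t0).
by apply: (eq_measurable_fun (fun=> 2 / t)) => // z _; rewrite mass_f.
Qed.

Lemma rhs_defined_f t : 0 < t -> rhs_defined f t.
Proof.
move=> t0; have iFt := L1_F t0; split.
- exact: in_L1_f.
- exact: ae_integrable_collision (in_L1_f t0).
- have iQ : L1 (fun z => 2^-1 * conv (F t) (F t) z + (- (2 / t) * F t z)).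
    apply: L1_lin; first exact: integrable_conv.
    exact: integrable_EFinZl.
  apply: (integrable_ae_eq (@measurable_phase R)).
  + by apply/measurable_EFinP; exact: measurable_rhs.
  + exact: integrableS measurableT (@measurable_phase R) (@subsetT _ _) iQ.
  + apply: filterS (ae_rhs t0) => z rE /rE ->.
    by rewrite /= mulNr.
Qed.

(** Solving the resolvent identity for [F s] gives an increment in which both coefficients carry the
    factor [s - t], hence the Lipschitz bound. *)
Lemma norm1_increment s t : 0 < s -> 0 < t ->
  norm1 (fun z => - 1 * F t z + F s z) <=
  `|(s - t) * (s + t) / s ^+ 2| * norm1 (F t) +
  `|t * (s - t) / (2 * s)| * (norm1 (F t) * norm1 (F s)).
Proof.
move=> s0 t0; have [iFs iFt] := (L1_F s0, L1_F t0).
have iC := integrable_conv iFt iFs.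
have iD : L1 (fun z => t * (s - t) / (2 * s) * conv (F t) (F s) z).
  exact: integrable_EFinZl.
rewrite (@norm1_ae_eq _ _ (fun z => - ((s - t) * (s + t) / s ^+ 2) * F t z +
   t * (s - t) / (2 * s) * conv (F t) (F s) z)); last 3 first.
- by apply: measurable_L1; exact: L1_lin.
- by apply: measurable_L1; exact: L1_lin.
- apply: filterS (resolvent_identity s0 t0) => z rz.
  have -> : F s z = (t ^+ 2 * F t z +
    t * s * (s - t) / 2 * conv (F t) (F s) z) / s ^+ 2.
    by rewrite -rz; field; rewrite gt_eqF.
  by field; rewrite gt_eqF.
apply: le_trans (norm1_lin _ _ _) _ => //; rewrite normrN lerD2l.
rewrite /norm1; under eq_Rintegral do rewrite normrM.
rewrite RintegralZl//; last exact: integrable_norm.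
by rewrite ler_wpM2l//; exact: norm1_conv.
Qed.

Lemma norm1_difference_quotient s t : 0 < s -> 0 < t -> s != t ->
  norm1 (fun z => (F s z - F t z) / (s - t) -
    (2^-1 * conv (F t) (F t) z - 2 / t * F t z)) <=
  `|(s - t) * (t + 2 * s) / (t * s ^+ 2)| * norm1 (F t) +
  (2^-1 * (norm1 (F t) * norm1 (fun z => - 1 * F t z + F s z)) +
   `|(s - t) / (2 * s)| * (norm1 (F t) * norm1 (F s))).
Proof.
move=> s0 t0 st; have [iFs iFt] := (L1_F s0, L1_F t0).
have iD : L1 (fun z => - 1 * F t z + F s z) by exact: L1_lin.
have iC := integrable_conv iFt iFs; have iCt := integrable_conv iFt iFt.
have iCD := integrable_conv iFt iD.
have i1 : L1 (fun z => - ((s - t) / (2 * s)) * conv (F t) (F s) z).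
  exact: integrable_EFinZl.
have i2 := L1_lin 2^-1 iCD i1.
(* The coefficient of [F t] is 2 / t - (s + t) / s^2, which factors through [s - t]. Writing t / (2
   s) = 1 / 2 - (s - t) / (2 s) in front of [conv (F t) (F s)] leaves half the convolution of [F t]
   with the increment. *)
rewrite (@norm1_ae_eq _ _ (fun z =>
   (s - t) * (t + 2 * s) / (t * s ^+ 2) * F t z +
   (2^-1 * conv (F t) (fun z => - 1 * F t z + F s z) z +
    - ((s - t) / (2 * s)) * conv (F t) (F s) z))); last 3 first.
- have := measurable_L1 (L1_lin (s - t)^-1 iD (L1_lin (- 2^-1) iCt
     (integrable_EFinZl (2 / t) measurableT iFt))).
  by congr measurable_fun; apply/funext => z /=; ring.
- by apply: measurable_L1; exact: L1_lin.
- apply: filterS2 (resolvent_identity s0 t0) (ae_conv_linr (- 1) iFt iFt iFs) =>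
    z rz ->.
  have -> : F s z = (t ^+ 2 * F t z +
    t * s * (s - t) / 2 * conv (F t) (F s) z) / s ^+ 2.
    by rewrite -rz; field; rewrite gt_eqF.
  by field; rewrite subr_eq0 st !gt_eqF.
apply: le_trans (norm1_lin _ _ _) _ => //; rewrite lerD2l.
apply: le_trans (norm1_lin _ _ _) _ => //.
rewrite ger0_norm// lerD//.
  by rewrite ler_wpM2l//; exact: norm1_conv.
rewrite /norm1; under eq_Rintegral do rewrite normrM.
rewrite RintegralZl//; last exact: integrable_norm.
by rewrite normrN ler_wpM2l//; exact: norm1_conv.
Qed.

Lemma integral_difference_quotient s t : 0 < s -> 0 < t -> s != t ->
  (\int[leb2 R]_(z in phase R)
     (`| (f s z.1 z.2 - f t z.1 z.2) / (s - t) - rhs f t z.1 z.2 |)%:E =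
   (norm1 (fun z => (F s z - F t z) / (s - t) -
      (2^-1 * conv (F t) (F t) z - 2 / t * F t z)))%:E)%E.
Proof.
move=> s0 t0 st; have [iFs iFt] := (L1_F s0, L1_F t0).
have iD : L1 (fun z => (F s z - F t z) / (s - t) -
    (2^-1 * conv (F t) (F t) z - 2 / t * F t z)).
  have := L1_lin (s - t)^-1 (L1_lin (- 1) iFt iFs)
    (L1_lin (- 2^-1) (integrable_conv iFt iFt)
     (integrable_EFinZl (2 / t) measurableT iFt)).
  by apply: eq_integrable => // z _ /=; congr EFin; ring.
have mphase := @measurable_phase R.
have mf r : 0 < r -> measurable_fun (phase R : set T)
  (fun z : T => f r z.1 z.2).
  by move=> r0; apply/measurable_EFinP; exact: measurable_int (in_L1_f r0).
rewrite -(norm1E iD).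
transitivity (\int[mu2]_(z in phase R) (`|(F s z - F t z) / (s - t) -
   (2^-1 * conv (F t) (F t) z - 2 / t * F t z)|)%:E)%E.
  apply: ae_eq_integral => //.
  - apply/measurable_EFinP; apply: measurableT_comp => //.
    apply: measurable_funB; last exact: measurable_rhs.
    by apply: measurable_funM => //; apply: measurable_funB; exact: mf.
  - apply/measurable_EFinP; apply: measurableT_comp => //;
      apply: measurable_funTS.
    exact: measurable_L1 iD.
  - apply: filterS (ae_rhs t0) => z rE zp;
      have z0 : 0 < (z.1 : R) by exact/in_phase.
    by rewrite rE// /F !ext_pos.
rewrite integral_mkcond; apply: eq_integral => z _; rewrite patchE;
  case: ifPn => //.
rewrite notin_setE => /in_phase/negP; rewrite -leNgt => z0.
rewrite !F_supp// conv_supp//; [|exact: F_supp|exact: F_supp].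
by rewrite subrr mul0r !mulr0 subrr subr0 normr0.
Qed.

Lemma L1_derivative_f t : 0 < t -> L1_derivative f t (rhs f t).
Proof.
move=> t0; rewrite /L1_derivative.
pose N := norm1 (F t); pose r := 2 / t; pose G := norm1 (ext g).
(* For |h| < t / 2 the time s = t + h satisfies 1 / s <= r, t + 2 s <= 4 t and s + t <= 5 t / 2; the
   norm of [F s] is at most [r * G]. These bounds turn the two previous estimates into [K * |h|]. *)
pose K := 4 * r ^+ 2 * N +
  (2^-1 * (N * (5 / 2 * t * r ^+ 2 * N + t * r / 2 * (N * (r * G))))
   + r / 2 * (N * (r * G))).
apply: (@squeeze_cvge _ _ _ _ (fun=> 0%E) _ (fun h => (K * `|h|)%:E)).
- near=> h; rewrite integral_ge0/=; last by move=> z _; rewrite lee_fin.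
  have h0 : h != 0 by near: h; exact: nbhs_dnbhs_neq.
  have ht : `|h| < t / 2.
    near: h; by apply: dnbhs0_lt; rewrite divr_gt0.
  have [h1 h2] : - (t / 2) < h /\ h < t / 2 by move: ht;
    rewrite ltr_norml => /andP[].
  have s2 : t / 2 <= t + h by lra.
  have s0 : 0 < t + h by apply: lt_le_trans s2; rewrite divr_gt0.
  have st : t + h != t by rewrite -subr_eq0 addrC addKr.
  have sth : t + h - t = h by rewrite addrC addKr.
  have i0 : 0 <= (t + h)^-1 by rewrite invr_ge0 ltW.
  have ir : (t + h)^-1 <= r.
    by rewrite /r -[2 / t]invrK invf_div lef_pV2// posrE divr_gt0.
  have r0 : 0 <= r by rewrite divr_ge0// ltW.
  have [N0 G0] : 0 <= N /\ 0 <= G by split; exact: norm1_ge0.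
  have iir : (t + h)^-1 ^+ 2 <= r ^+ 2 by rewrite ler_sqr.
  have := integral_difference_quotient s0 t0 st; rewrite sth => ->;
    rewrite lee_fin.
  have := norm1_difference_quotient s0 t0 st; have := norm1_increment s0 t0.
  rewrite sth (norm1_dilate ig s0) -/N -/G; set D := norm1 _ => leD le1.
  have hr : `|h / (2 * (t + h))| <= `|h| * (r / 2).
    rewrite invfM normrM ler_wpM2l// ger0_norm ?mulr_ge0// mulrC ler_wpM2r//.
  have NM : N * ((t + h)^-1 * G) <= N * (r * G)
    by rewrite ler_wpM2l// ler_wpM2r.
  have NM0 : 0 <= N * ((t + h)^-1 * G) by rewrite !mulr_ge0.
  have e1 : `|h * (t + 2 * (t + h)) / (t * (t + h) ^+ 2)| <=
    `|h| * (4 * r ^+ 2).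
    rewrite -mulrA normrM ler_wpM2l// invfM -exprVn mulrA normrM
      (ger0_norm (sqr_ge0 _)).
    apply: ler_pM (normr_ge0 _) (sqr_ge0 _) _ iir;
      rewrite normrM normfV (gtr0_norm t0) ler_pdivrMr//.
    by rewrite ger0_norm; lra.
  have e2 : `|h * (t + h + t) / (t + h) ^+ 2| <= `|h| * (5 / 2 * t * r ^+ 2).
    rewrite -mulrA normrM ler_wpM2l// -exprVn normrM (ger0_norm (sqr_ge0 _)).
    by apply: ler_pM (normr_ge0 _) (sqr_ge0 _) _ iir; rewrite ger0_norm; lra.
  have e3 : `|t * h / (2 * (t + h))| <= `|h| * (t * r / 2).
    rewrite -mulrA normrM (ger0_norm (ltW t0))
      (_ : `|h| * _ = t * (`|h| * (r / 2))).
      by rewrite ler_wpM2l// ltW.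
    by rewrite /r; ring.
  apply: le_trans le1 _.
  rewrite (_ : K * `|h| = `|h| * (4 * r ^+ 2) * N +
    (2^-1 * (N * (`|h| * (5 / 2 * t * r ^+ 2) * N +
      `|h| * (t * r / 2) * (N * (r * G)))) +
     `|h| * (r / 2) * (N * (r * G)))); last by rewrite /K; ring.
  rewrite lerD ?ler_wpM2r// lerD//; last by rewrite ler_pM.
  rewrite ler_wpM2l// ler_wpM2l// (le_trans leD)// lerD ?ler_wpM2r//.
  by rewrite ler_pM.
- exact: cvg_cst.
- apply: cvg_EFin; first exact: nearW.
  rewrite -[X in _ --> X](mulr0 K); apply: cvgM; first exact: cvg_cst.
  rewrite -[X in _ --> X](normr0 R); apply: cvg_norm; exact: cvg_within.
Unshelve. all: by end_near.
Qed.

End strong.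

(** * The pointwise equation *)

Section pointwise.
Context {R : realType}.
Local Notation mR := (measurableTypeR R).
Local Notation T := (measurableTypeR R * measurableTypeR R)%type.
Local Notation mu := (@lebesgue_measure R).
Local Notation mu2 := (lebT R).

Lemma is_derive_quotient (F : R -> R) (t l : R) :
  (F (t + h) - F t) / h @[h --> 0^'] --> l -> is_derive t 1 F l.
Proof.
move=> cF.
have E : (fun h : R => h^-1 *: ((F \o shift t) (h *: (1 : R)) - F t)) =
    fun h => (F (t + h) - F t) / h.
  by apply/funext => h; rewrite /= [_ *: 1]mulr1 [h + t]addrC; exact: mulrC.
by apply: DeriveDef; rewrite /derivable /derive E;
  [apply/cvg_ex; exists l|exact: cvg_lim].
Qed.

Lemma mean_value (F dF : R -> R) (a s : R) :
  (forall x, `|x - a| <= `|s - a| -> is_derive x 1 F (dF x)) ->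
  exists2 c, `|c - a| <= `|s - a| & F s - F a = dF c * (s - a).
Proof.
move=> dFx.
have cF x y : (forall z, z \in `[x, y] -> `|z - a| <= `|s - a|) ->
    {within `[x, y], continuous F}.
  move=> xy; apply: derivable_within_continuous => z /xy /dFx.
  by case.
have [as_|sa] := leP a s.
  have H z : z \in `[a, s] -> `|z - a| <= `|s - a|.
    by rewrite in_itv/= => /andP[az zs]; rewrite !ger0_norm ?subr_ge0// lerD2r.
  have D z : z \in `]a, s[ ->
    is_derive z 1 F (dF z) by move=> /subset_itv_oo_cc/H/dFx.
  have [c cas E] := MVT_segment as_ D (cF _ _ H).
  by exists c => //; exact: H.
have H z : z \in `[s, a] -> `|z - a| <= `|s - a|.
  rewrite in_itv/= => /andP[sz za]; rewrite !ler0_norm ?subr_le0 ?(ltW sa)//.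
  by rewrite lerN2 lerD2r.
have D z : z \in `]s, a[ ->
  is_derive z 1 F (dF z) by move=> /subset_itv_oo_cc/H/dFx.
have [c csa E] := MVT_segment (ltW sa) D (cF _ _ H).
by exists c; [exact: H|rewrite -opprB E; ring].
Qed.

Lemma continuous3_near (F : R * R * R -> R) (t m p : R) :
  {for ((t, m), p), continuous F} -> forall e, 0 < e ->
  exists2 d, 0 < d & forall s m' p', `|s - t| < d -> `|m' - m| < d ->
    `|p' - p| < d ->
    `|F ((s, m'), p') - F ((t, m), p)| <= e.
Proof.
move=> /cvgrPdist_le cF e e0; have /nbhs_ballP[d d0 H] := cF _ e0.
exists d => // s m' p' sd md pd; rewrite distrC; apply: (H ((s, m'), p')).
by split; [split|] => /=; rewrite /ball/= distrC.
Qed.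

Definition box (m p r : R) : set T := ball m r `*` ball p r.

Lemma measurable_box m p r : measurable (box m p r).
Proof. by apply: measurableX; exact: measurable_ball. Qed.

Lemma measure_box m p r : 0 < r -> mu2 (box m p r) = ((r *+ 2) ^+ 2)%:E.
Proof.
move=> r0; rewrite [LHS]product_measure1E; [|exact: measurable_ball..].
rewrite [X in (X * _)%E](lebesgue_measure_ball m (ltW r0)).
by rewrite [X in (_ * X)%E](lebesgue_measure_ball p (ltW r0)) -EFinM expr2.
Qed.

Lemma box_average (u : T -> R) m p r (c e : R) : 0 < r ->
  mu2.-integrable (box m p r) (EFin \o u) ->
  (forall z, box m p r z -> `|u z - c| <= e) ->
  `|\int[mu2]_(z in box m p r) u z - c * (r *+ 2) ^+ 2| <= e * (r *+ 2) ^+ 2.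
Proof.
move=> r0 iu ue; have mB := measurable_box m p r.
have icst k : mu2.-integrable (box m p r) (EFin \o (fun=> k)).
  apply: measurable_bounded_integrable => //; last exact: bounded_cst.
  have := ltry ((r *+ 2) ^+ 2); by rewrite -(measure_box m p r0).
have intc k : \int[mu2]_(z in box m p r) k = k * (r *+ 2) ^+ 2.
  rewrite Rintegral_cst//; congr (_ * _).
  exact: (congr1 fine (measure_box m p r0)).
rewrite -!intc -RintegralB//.
have iuc : mu2.-integrable (box m p r) (EFin \o (fun z => u z - c)).
  by have := integrableB mB iu (icst c); exact: eq_integrable.
apply: le_trans (le_normr_Rintegral _ _) _ => //.
by apply: le_Rintegral => //; exact: integrable_norm.
Qed.

Lemma classical_of_L1 (f Q : R -> R -> R -> R) :
  (forall t, 0 < t -> in_L1 (f t)) -> (forall t, 0 < t -> in_L1 (Q t)) ->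
  (forall t, 0 < t -> L1_derivative f t (Q t)) ->
  continuous_density f -> continuous_density Q ->
  forall t m p : R, 0 < t -> 0 < m ->
    is_derive t 1 (fun s => f s m p) (Q t m p).
Proof.
move=> if_ iQ dfQ cf cQ t m p t0 m0.
have sub_phase r : r <= m -> box m p r `<=` (phase R : set T).
  move=> rm z [+ _]; rewrite /ball/= => zr; apply/in_phase.
  by move: zr; rewrite ltr_norml => /andP[_]; lra.
have integrable_box r u : r <= m -> in_L1 u ->
    mu2.-integrable (box m p r) (fun z : T => (u z.1 z.2)%:E).
  move=> rm iu; apply: integrableS iu => //.
  - exact: measurable_phase.
  - exact: measurable_box.
  - exact: sub_phase.
(* The error in the difference quotient of a box integral is at most the L^1 error over the phase
   space, so box integrals are differentiable in the ordinary sense. *)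
have derive_box (r s : R) : r <= m -> 0 < s ->
    is_derive s 1 (fun s : R => \int[mu2]_(z in box m p r) f s z.1 z.2)
      (\int[mu2]_(z in box m p r) Q s z.1 z.2).
  move=> rm s0; apply: is_derive_quotient; apply/cvgrPdist_le => e e0.
  have [fin_D cvg_D] := (fine_cvgP _ _).1 (dfQ s s0).
  have mB := measurable_box m p r.
  near=> h.
  have h0 : h != 0 by near: h; exact: nbhs_dnbhs_neq.
  have hs : 0 < s + h.
    have : `|h| < s by near: h; exact: dnbhs0_lt.
    by rewrite ltr_norml => /andP[]; lra.
  have [i1 i0 iq] := And3 (integrable_box r _ rm (if_ _ hs))
    (integrable_box r _ rm (if_ _ s0))
    (integrable_box r _ rm (iQ _ s0)).
  pose w (z : T) := (f (s + h) z.1 z.2 - f s z.1 z.2) / h - Q s z.1 z.2.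
  have i10 : mu2.-integrable (box m p r)
    (EFin \o (fun z : T => f (s + h) z.1 z.2 - f s z.1 z.2)).
    by have := integrableB mB i1 i0; exact: eq_integrable.
  have i10h : mu2.-integrable (box m p r)
    (EFin \o (fun z : T => (f (s + h) z.1 z.2 - f s z.1 z.2) / h)).
    have := integrable_EFinZl h^-1 mB i10; apply: eq_integrable => // z _.
    by rewrite /= mulrC.
  have iw : mu2.-integrable (box m p r) (EFin \o w).
    by have := integrableB mB i10h iq; exact: eq_integrable.
  have -> : \int[mu2]_(z in box m p r) Q s z.1 z.2 -
     (\int[mu2]_(z in box m p r) f (s + h) z.1 z.2 -
       \int[mu2]_(z in box m p r) f s z.1 z.2) / h =
     - \int[mu2]_(z in box m p r) w z.
    by rewrite RintegralB// RintegralZr// RintegralB// opprB.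
  rewrite normrN -lee_fin EFin_normr_Rintegral//.
  have finDh : (\int[leb2 R]_(z in phase R)
     (`| (f (s + h) z.1 z.2 - f s z.1 z.2) / h - Q s z.1 z.2 |)%:E)%E \is a
       fin_num.
    by near: h.
  have De : fine (\int[leb2 R]_(z in phase R)
     (`| (f (s + h) z.1 z.2 - f s z.1 z.2) / h - Q s z.1 z.2 |)%:E)%E <= e.
    near: h; move/cvgrPdist_le : cvg_D => /(_ _ e0); apply: filterS => h /=.
    by rewrite sub0r normrN; apply: le_trans; exact: ler_norm.
  apply: le_trans (le_abse_integral _ _ _) _ => //;
    first exact: measurable_int iw.
  apply: (@le_trans _ _ (\int[leb2 R]_(z in phase R) (`|w z|)%:E)%E).
    apply: ge0_subset_integral => //.
    - exact: measurable_phase.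
    - have mf u : in_L1 u -> measurable_fun (phase R : set T)
        (fun z : T => u z.1 z.2).
        by move=> iu; apply/measurable_EFinP; exact: measurable_int iu.
      apply/measurable_EFinP; apply: measurableT_comp => //.
      apply: measurable_funB; last by apply: mf; exact: iQ.
      apply: measurable_funM => //.
      by apply: measurable_funB; apply: mf; exact: if_.
    - exact: sub_phase.
  by rewrite -(fineK finDh) lee_fin.
(* With [s] fixed the box may shrink: replacing [f] by its box averages at the two times costs [eta]
   in all, which tends to 0, while the oscillation [e] of [Q] keeps the factor [|s - t|]. *)
have increment (s e : R) : 0 < e -> (exists2 d, 0 < d & forall t' m' p',
     `|t' - t| <= `|s - t| -> `|m' - m| < d -> `|p' - p| < d ->
       `|Q t' m' p' - Q t m p| <= e) ->
    (forall t', `|t' - t| <= `|s - t| -> 0 < t') ->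
    `|f s m p - f t m p - (s - t) * Q t m p| <= e * `|s - t|.
  move=> e0 [d d0 Qd] pos; apply/ler_addgt0Pr => eta eta0.
  have eta20 : 0 < eta / 2 by rewrite divr_gt0.
  have s0 : 0 < s by exact: pos.
  have [d1 d10 fs] := continuous3_near (cf _ _ p s0 m0) eta20.
  have [d2 d20 ft] := continuous3_near (cf _ _ p t0 m0) eta20.
  pose r := Num.min m (Num.min d (Num.min d1 d2)).
  have r0 : 0 < r by rewrite !lt_min m0 d0 d10 d20.
  have rm : r <= m by rewrite ge_min lexx.
  have boxE z : box m p r z -> [/\ `|z.1 - m| < r & `|z.2 - p| < r].
    by move=> [/=]; rewrite /ball/= !(distrC m) !(distrC p).
  have [rd rd1 rd2] : [/\ r <= d, r <= d1 & r <= d2]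
    by rewrite !ge_min !lexx !orbT.
  pose k := (r *+ 2) ^+ 2.
  have k0 : 0 < k by rewrite exprn_gt0// mulrn_wgt0.
  have As := box_average r0 (integrable_box r _ rm (if_ _ s0)) (c := f s m p)
    (e := eta / 2).
  have At := box_average r0 (integrable_box r _ rm (if_ _ t0)) (c := f t m p)
    (e := eta / 2).
  (* The mean value theorem is applied to the box integral, so a single time [c] serves the whole
     box; for [f] at a point no derivative is available yet. *)
  have [c ct E] := @mean_value _ _ t s
    (fun x xt => derive_box r x rm (pos x xt)).
  have AQ := box_average r0 (integrable_box r _ rm (iQ _ (pos _ ct)))
    (c := Q t m p) (e := e).
  move: As => /(_ _)/wrap[|As].
    by move=> z /boxE[z1 z2]; apply: fs;
      rewrite ?subrr ?normr0// (lt_le_trans _ rd1).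
  move: At => /(_ _)/wrap[|At].
    by move=> z /boxE[z1 z2]; apply: ft;
      rewrite ?subrr ?normr0// (lt_le_trans _ rd2).
  move: AQ => /(_ _)/wrap[|AQ].
    by move=> z /boxE[z1 z2]; apply: Qd => //; rewrite (lt_le_trans _ rd).
  move: As At AQ E; rewrite -/k.
  set Is := \int[mu2]_(z in _) _; set It := \int[mu2]_(z in _) _; set J :=
    \int[mu2]_(z in _) _.
  move=> As At AQ E.
  rewrite -(ler_pM2r k0) -{1}(gtr0_norm k0) -normrM.
  have -> : (f s m p - f t m p - (s - t) * Q t m p) * k =
    - (Is - f s m p * k) + ((It - f t m p * k) + (s - t) * (J - Q t m p * k)).
    have -> : Is = It + J * (s - t) by rewrite -E; ring.
    by ring.
  apply: le_trans (ler_normD _ _) _; rewrite normrN.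
  have := ler_normD (It - f t m p * k) ((s - t) * (J - Q t m p * k)).
  have : `|(s - t) * (J - Q t m p * k)| <= `|s - t| * (e * k).
    by rewrite normrM ler_wpM2l.
  rewrite (_ : (e * `|s - t| + eta) * k = eta / 2 * k +
    (eta / 2 * k + `|s - t| * (e * k))); last by field.
  lra.
apply: is_derive_quotient; apply/cvgrPdist_le => e e0.
have [d d0 Qd] := continuous3_near (cQ _ _ p t0 m0) e0.
near=> h.
have h0 : h != 0 by near: h; exact: nbhs_dnbhs_neq.
have hd : `|h| < d by near: h; exact: dnbhs0_lt.
have ht : `|h| < t by near: h; exact: dnbhs0_lt.
have := increment (t + h) e e0.
rewrite (_ : t + h - t = h); last by ring.
move=> H; have {}H : `|f (t + h) m p - f t m p - h * Q t m p| <= e * `|h|.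
  apply: H; first by exists d => // t' m' p' t'h; apply: Qd;
    exact: le_lt_trans hd.
  by move=> t' t'h; have := le_lt_trans t'h ht; rewrite ltr_norml => /andP[];
    lra.
rewrite -(ler_pM2r (_ : 0 < `|h|)) ?normr_gt0// -normrM.
rewrite (_ : (_ - _) * h = - (f (t + h) m p - f t m p - h * Q t m p));
  last by field.
by rewrite normrN.
Unshelve. all: by end_near.
Qed.

End pointwise.

(** * Self-similar form, continuity of the right-hand side, conclusion *)

Section self_similar_solution.
Context {R : realType}.
Variables (Phi : R -> R) (g : R -> R -> R).
Hypothesis g_def : is_inverse_fourier_laplace
  (fun zeta xi => 2 / (2 * zeta * Phi (xi ^+ 2 / zeta) + 1)) g.

Lemma self_similar_dilate : self_similar (5 / 2) (1 / 2) (dilate g).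
Proof.
exists g => t m p t0 m0; rewrite /dilate (mulrC m) (mulrC p).
by rewrite [X in _ = _ * g _ (X * _)]powRN div1r powR12_sqrt// ltW.
Qed.

(** By the explicit total mass, the loss is the density times [2 / s], so it inherits the continuity
    of the density. This formula is available at positive times, whence the restriction to a
    neighborhood. *)
Lemma continuous_rhs : continuous_density (dilate g) ->
  continuous_density (gain (dilate g)) -> continuous_density (rhs (dilate g)).
Proof.
move=> cf cgain t m p t0 m0.
have c11 : z.1.1 @[z --> ((t, m), p)] -->
  t by exact: (cvg_comp _ _ cvg_fst cvg_fst).
have t_near : \forall z \near ((t, m), p), 0 < z.1.1
  by exact: c11 (lt_nbhsr t0).
have rE s x y : 0 < s ->
    rhs (dilate g) s x y = gain (dilate g) s x y - dilate g s x y * (2 / s).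
  by move=> s0; rewrite /rhs /loss (mass_f g_def s0).
rewrite /prop_for /continuous_at /= rE//.
have : (gain (dilate g) z.1.1 z.1.2 z.2 -
  dilate g z.1.1 z.1.2 z.2 * (2 / z.1.1))
   @[z --> ((t, m), p)] --> gain (dilate g) t m p - dilate g t m p * (2 / t).
  apply: cvgB; first exact: cgain.
  apply: cvgM; first exact: cf.
  apply: cvgM; first exact: cvg_cst.
  by apply: cvgV; [rewrite gt_eqF|exact: c11].
apply: cvg_trans; apply: near_eq_cvg; apply: filterS t_near => z z0.
by rewrite rE.
Qed.

End self_similar_solution.

Theorem theorem2 (R : realType) (Phi : R -> R) (g : R -> R -> R)
    (Phi_C1 : C1 Phi)
    (denom_neq0 : forall zeta xi : R, 0 < zeta ->
       2 * zeta * Phi (xi ^+ 2 / zeta) + 1 != 0)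
    (g_def : is_inverse_fourier_laplace
       (fun zeta xi => 2 / (2 * zeta * Phi (xi ^+ 2 / zeta) + 1)) g) :
  let f := fun t m p : R => t `^ (- (5 / 2)) * g (m / t) (p / Num.sqrt t) in
  self_similar (5 / 2) (1 / 2) f /\ solution f.
Proof.
change (self_similar (5 / 2) (1 / 2) (dilate g) /\ solution (dilate g)).
split; first exact: self_similar_dilate.
split=> [t t0|cf cgain t m p t0 m0].
  split; first exact: (rhs_defined_f g_def).
  exact: (L1_derivative_f denom_neq0 g_def).
apply: (classical_of_L1 (f := dilate g)) => //.
- by move=> s s0; have [] := rhs_defined_f g_def s0.
- by move=> s s0; have [] := rhs_defined_f g_def s0.
- by move=> s s0; exact: (L1_derivative_f denom_neq0 g_def).
- exact: (continuous_rhs g_def).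
Qed.
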